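(* There exist an integer $n\ge 1$ and an irreducible hypersurface germ $(X,\bar 0)\subset(\mathbb{C}^{n+1},\bar 0)$ such that for every smooth surface germ $(Y,\bar 0)\subset(\mathbb{C}^{n+1},\bar 0)$ the intersection germ $(X\cap Y,\bar 0)$ is reducible.
   Context: A hypersurface germ in $(\mathbb{C}^{n+1},\bar 0)$ is the zero set germ of some nonzero non-unit $F\in\mathbb{C}\{x_1,\dots,x_{n+1}\}$. A smooth surface germ is the germ at $\bar 0$ of a $2$-dimensional complex submanifold through $\bar 0$. Reducible means reducible as a (reduced) complex analytic germ at $\bar 0$. *)

(* Defs.v *)
From HB Require Import structures.
From mathcomp Require Import all_boot all_order all_algebra complex.
From mathcomp Require Import all_classical all_reals all_analysis.
Set Implicit Arguments. Unset Strict Implicit. Unset Printing Implicit Defensive.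
Import Order.TTheory GRing.Theory Num.Theory numFieldNormedType.Exports.
Local Open Scope classical_set_scope.
Local Open Scope ring_scope.
Local Open Scope complex_scope.

(* C^n. The alias R[i]^o of the complex numbers R[i] is the one that carries
   the library's topology and norm. *)
Definition Cspace (R : realType) (n : nat) := 'rV[R[i]^o]_n.

Definition multi_index (n : nat) := {ffun 'I_n -> nat}.

Definition mi_deg (n : nat) (m : multi_index n) : nat := (\sum_i m i)%N.

(* Formal power series in n variables, given by their coefficients. *)
Definition pseries (R : realType) (n : nat) := multi_index n -> R[i]^o.

(* a is in C{x_1, ..., x_n}: sum_m |a_m| r^|m| < oo for some r > 0. A single
   radius is enough, as a polyradius can be replaced by its least entry. *)
Definition convergent (R : realType) (n : nat) (a : pseries R n) : Prop :=
  exists2 r : R, 0 < r &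
    summable [set: multi_index n]
      (fun m => (ComplexField.Normc.normc (a m) * r ^+ mi_deg m)%:E).

(* The sum of the series at x, as the limit of the partial sums over the boxes
   {0, ..., N-1}^n. On a polydisc on which a converges absolutely this does not
   depend on the order of summation; where the limit does not exist it is a
   junk value, so only its germ at 0, for a convergent, is meaningful. *)
Definition ps_partial (R : realType) (n : nat) (a : pseries R n)
    (x : Cspace R n) (N : nat) : R[i]^o :=
  \sum_(m : {ffun 'I_n -> 'I_N})
     a [ffun i => nat_of_ord (m i)] * \prod_(i < n) x 0 i ^+ m i.

Definition ps_eval (R : realType) (n : nat) (a : pseries R n)
    (x : Cspace R n) : R[i]^o :=
  lim (ps_partial a x N @[N --> \oo]).

Definition ps_one (R : realType) (n : nat) : pseries R n :=
  fun m => (mi_deg m == 0%N)%:R.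

(* Cauchy product: the sum over all k with k i <= m i for every i. *)
Definition ps_mul (R : realType) (n : nat) (a b : pseries R n) : pseries R n :=
  fun m => \sum_(k : {dffun forall i : 'I_n, 'I_(m i).+1})
     a [ffun i => nat_of_ord (k i)] * b [ffun i => (m i - k i)%N].

(* Invertibility in the ring C{x_1, ..., x_n}. *)
Definition ps_unit (R : realType) (n : nat) (a : pseries R n) : Prop :=
  exists2 b : pseries R n, convergent b & ps_mul a b = @ps_one R n.

(* Germs at 0 are represented by sets, compared up to equality near 0. *)
Definition germ_eq (R : realType) (n : nat) (A B : set (Cspace R n)) : Prop :=
  \forall x \near (0 : 'rV[R[i]^o]_n), A x <-> B x.

Definition zero_set (R : realType) (n : nat) (F : pseries R n) :
    set (Cspace R n) := [set x | ps_eval F x = 0].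

Definition analytic_germ (R : realType) (n : nat) (A : set (Cspace R n)) :
    Prop :=
  exists (k : nat) (F : 'I_k -> pseries R n),
    (forall j, convergent (F j)) /\
    germ_eq A (\bigcap_(j : 'I_k) zero_set (F j)).

Definition hypersurface_germ (R : realType) (n : nat) (X : set (Cspace R n)) :
    Prop :=
  exists F : pseries R n,
    [/\ convergent F, exists m, F m != 0, ~ ps_unit F &
        germ_eq X (zero_set F)].

Definition reducible_germ (R : realType) (n : nat) (A : set (Cspace R n)) :
    Prop :=
  exists A1 A2 : set (Cspace R n),
    [/\ analytic_germ A1, analytic_germ A2, germ_eq A (A1 `|` A2),
        ~ germ_eq A1 A & ~ germ_eq A2 A].

(* Non-emptiness excludes the unit ideal, which is not prime. *)
Definition irreducible_germ (R : realType) (n : nat) (A : set (Cspace R n)) :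
    Prop :=
  [/\ analytic_germ A, ~ germ_eq A set0 & ~ reducible_germ A].

Definition ps_map (R : realType) (n p : nat) (Phi : 'I_p -> pseries R n)
    (x : Cspace R n) : Cspace R p := \row_j ps_eval (Phi j) x.

(* Phi and Psi are mutually inverse germs of holomorphic maps
   (C^n, 0) -> (C^n, 0). *)
Definition biholomorphic_germ (R : realType) (n : nat)
    (Phi Psi : 'I_n -> pseries R n) : Prop :=
  [/\ forall j, convergent (Phi j), forall j, convergent (Psi j),
      ps_map Phi 0 = 0 /\ ps_map Psi 0 = 0,
      \forall x \near (0 : 'rV[R[i]^o]_n), ps_map Psi (ps_map Phi x) = x &
      \forall x \near (0 : 'rV[R[i]^o]_n), ps_map Phi (ps_map Psi x) = x].

(* A d-dimensional complex submanifold near its point 0: in some holomorphic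
   chart Phi of C^n centred at 0 it is the coordinate subspace on which all
   coordinates but the first d vanish. *)
Definition submanifold_germ (R : realType) (n d : nat) (Y : set (Cspace R n)) :
    Prop :=
  (d <= n)%N /\
  exists Phi Psi : 'I_n -> pseries R n,
    biholomorphic_germ Phi Psi /\
    germ_eq Y [set x | forall j : 'I_n, (d <= j)%N -> ps_map Phi x 0 j = 0].

Definition smooth_surface_germ (R : realType) (n : nat)
    (Y : set (Cspace R n)) : Prop := submanifold_germ 2 Y.

(* Main.v *)
(* [X] is the Brieskorn surface [x^40 + y^30 + z^24 = 0] in C^3, quasi-homogeneous for
   the weights 3, 4, 5.

   [X] is irreducible: expand a convergent series along the weighted C^*-orbits.  If
   [f g = 0] on [X] near 0, then [f_k g_l = 0] on all of [X] for any two weighted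
   homogeneous parts, and these are polynomials.  The coordinate ring of [X] is a domain:
   on the slices [z = z0], a nonzero polynomial of degree < 30 in [y] vanishes to finite
   order at a point with [y = 0], where the curve is smooth with local parameter [y].

   Every smooth section is reducible: a smooth surface is [Y = {h = 0}] with
   [h = x a + y b + z c] and [a], [b], [c] not all zero at 0.  On [Y] the coordinate of
   least weight whose coefficient does not vanish at 0 can be eliminated.  As the largest
   weight is less than twice the smallest, [F = x^40 + y^30 + z^24] becomes, up to a unit,
   [A^k + B^k + sum_m W_m A^m B^(k-m)] with [W_m(0) = 0], where [A] and [B] are powers of the
   remaining coordinates ([y^5, z^4] or [x^5, z^3] or [x^4, y^3]) and [k] is 6, 8 or 10.
   The simple roots of [t^k = -1] deform to convergent power series [lambda] (Hensel),
   so [A - lambda B] splits off on [Y].  Two such roots give curves in [X] and [Y] that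
   meet only at 0 near 0; each has points other than 0 by the contraction principle. *)

Require Import Defs.
From mathcomp Require Import all_boot all_order all_algebra complex.
From mathcomp Require Import all_classical all_reals all_analysis.
From mathcomp Require Import zify ring lra.
Set Implicit Arguments. Unset Strict Implicit. Unset Printing Implicit Defensive.
Import Order.TTheory GRing.Theory Num.Theory numFieldNormedType.Exports.
Local Open Scope classical_set_scope.
Local Open Scope ring_scope.
Local Open Scope complex_scope.

(** The exponents are 120/3, 120/4 and 120/5. Any two of them have a common factor, 6, 8 or 10, so
    two of the three powers alone form a sum of two [k]-th powers, which splits. All three together
    do not split. Elimination replaces a coordinate by terms of larger weight: linear in the heavier
    coordinates, at least quadratic in the lighter ones, whence the bound 2 on the ratio of weights.
    Larger weight alone does not make a monomial divisible by some [A^m B^(k-m)]. The size of the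
    exponents leaves enough slack for this, and a finite computation confirms it. As [k] is even,
    the roots of [t^k = -1] come in pairs [t0], [-t0]. Germs are compared as point sets, so every
    properness claim needs actual points arbitrarily close to 0. On the sections a contraction
    produces them. On [X] the action of small scalars does: the weights are positive, so it moves
    any point of [X], however far away, into a given neighbourhood of 0. The irreducibility of the
    germ thus becomes a statement about polynomials on all of [X]. *)

Section Modulus.
Variable R : realType.
Implicit Types (z w : R[i]) (u : nat -> R[i]).

(** The norm of [R[i]] takes its values in [R[i]]. A modulus with values in [R] keeps all estimates
    in an ordered field. *)
Definition nm z : R := ComplexField.Normc.normc z.

Arguments nm : simpl never.

Lemma nmE z : `|z| = (nm z)%:C.
Proof. by case: z => a b; rewrite normc_def. Qed.

Lemma nm_ge0 z : 0 <= nm z.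
Proof. by rewrite -lecR -nmE normr_ge0. Qed.
Hint Extern 0 (is_true (@Order.le _ _ _ (nm _))) => exact: nm_ge0 : core.

Lemma nm0 : nm 0 = 0. Proof. exact: Normc.normc0. Qed.
Lemma nm1 : nm 1 = 1. Proof. exact: Normc.normc1. Qed.
Lemma nmM z w : nm (z * w) = nm z * nm w. Proof. exact: Normc.normcM. Qed.
Lemma nmV z : nm z^-1 = (nm z)^-1. Proof. exact: Normc.normcV. Qed.
Lemma nmN z : nm (- z) = nm z. Proof. exact: normcN. Qed.
Lemma nmD z w : nm (z + w) <= nm z + nm w. Proof. exact: le_normcD. Qed.

Lemma nm_eq0 z : (nm z == 0) = (z == 0).
Proof.
apply/eqP/eqP => [/Normc.eq0_normc//|->]; exact: nm0.
Qed.

Lemma nm_gt0 z : (0 < nm z) = (z != 0).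
Proof. by rewrite lt_neqAle eq_sym nm_eq0 nm_ge0 andbT. Qed.

Lemma nmB z w : nm (z - w) <= nm z + nm w.
Proof. by apply: le_trans (nmD _ _) _; rewrite nmN. Qed.

Lemma nm_distC z w : nm (z - w) = nm (w - z).
Proof. by rewrite -nmN opprB. Qed.

Lemma nmX z k : nm (z ^+ k) = nm z ^+ k.
Proof. by elim: k => [|k IH]; rewrite ?expr0 ?nm1 // !exprS nmM IH. Qed.

Lemma nmR (r : R) : 0 <= r -> nm r%:C = r.
Proof.
by move=> r0; apply: complexI; rewrite -nmE ger0_norm // lecR.
Qed.

Lemma nm_sum (I : Type) (s : seq I) (P : pred I) (F : I -> R[i]) :
  nm (\sum_(j <- s | P j) F j) <= \sum_(j <- s | P j) nm (F j).
Proof.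
elim/big_rec2: _ => [|j y x _ h]; first by rewrite nm0.
by apply: le_trans (nmD _ _) _; rewrite lerD2l.
Qed.

Lemma nm_prod (I : Type) (s : seq I) (P : pred I) (F : I -> R[i]) :
  nm (\prod_(j <- s | P j) F j) = \prod_(j <- s | P j) nm (F j).
Proof. by elim/big_rec2: _ => [|j y x _ <-]; rewrite ?nm1 ?nmM. Qed.

Lemma nm_Re z : `|complex.Re z| <= nm z.
Proof. by have := normc_ge_Re z; rewrite nmE lecR. Qed.

Lemma nmi : nm ('i : R[i]) = 1.
Proof. by apply: complexI; rewrite -nmE complexiE normCi. Qed.

Lemma nm_Im z : `|complex.Im z| <= nm z.
Proof.
have := nm_Re (z * 'i); rewrite nmM nmi mulr1.
by case: z => a b /=; rewrite mulr0 mulr1 sub0r normrN.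
Qed.

Lemma nm_le z : nm z <= `|complex.Re z| + `|complex.Im z|.
Proof.
case: z => a b /=; have -> : a +i* b = a%:C + 'i * b%:C by simpc.
apply: le_trans (nmD _ _) _; rewrite nmM.
have e (c : R) : nm c%:C = `|c|.
  by apply: complexI; rewrite -nmE normc_def /= expr0n addr0 sqrtr_sqr.
by rewrite nmi mul1r !e.
Qed.

(** Convergence with real tolerances; [clim_lim] is its link to the topological limit in
    [ps_eval]. *)
Definition clim u l := forall e : R, 0 < e ->
  exists N, forall k, (N <= k)%N -> nm (u k - l) < e.

Lemma clim_lim u l : clim u l -> lim ((u k : R[i]^o) @[k --> \oo]) = (l : R[i]^o).
Proof.
move=> ul; apply: cvg_lim => //; apply/cvgrPdist_lt => e e0.
(* Here [e] is a positive element of [R[i]], hence real. *)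
have er : e = (complex.Re e)%:C.
  by case: e e0 => a b; rewrite ltcE /= => /andP[/eqP ->].
have re0 : 0 < complex.Re e by rewrite -ltcR -er.
have [N HN] := ul _ re0; exists N => // k /= /HN.
by rewrite nm_distC -ltcR -er -nmE.
Qed.

Lemma clim_ext u u' l : u =1 u' -> clim u l -> clim u' l.
Proof. by move=> /funext ->. Qed.

Lemma clim_nm_le u l (M : R) (N : nat) :
  clim u l -> (forall k, (N <= k)%N -> nm (u k) <= M) -> nm l <= M.
Proof.
move=> ul uM; apply/ler_addgt0Pr => e e0.
have [K HK] := ul _ e0; set k := maxn N K.
have -> : l = u k - (u k - l) by rewrite opprB addrC subrK.
apply: le_trans (nmB _ _) _; apply: lerD; first by apply: uM; rewrite leq_maxl.
by apply/ltW/HK; rewrite leq_maxr.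
Qed.

Lemma climD u v l m : clim u l -> clim v m -> clim (fun k => u k + v k) (l + m).
Proof.
move=> ul vm e e0; have e2 : 0 < e / 2 by rewrite divr_gt0.
have [N HN] := ul _ e2; have [K HK] := vm _ e2.
exists (maxn N K) => k; rewrite geq_max => /andP[/HN h1 /HK h2].
by rewrite opprD addrACA (le_lt_trans (nmD _ _))// (splitr e) ltrD.
Qed.

Lemma clim_sqz u (v : nat -> R) l : (forall k, nm (u k - l) <= v k) ->
  (forall e : R, 0 < e -> exists N, forall k, (N <= k)%N -> v k < e) -> clim u l.
Proof.
move=> uv vlim e /vlim[N HN]; exists N => k /HN; exact: le_lt_trans.
Qed.

Lemma climM u v l m : clim u l -> clim v m -> clim (fun k => u k * v k) (l * m).
Proof.
move=> ul vm e e0.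
(* As [d <= 1], the product of the two errors is at most [d], and the total error at most
   [d (1 + |l| + |m|) <= e]. *)
pose d := Num.min 1 (e / (1 + nm l + nm m)).
have s0 : 0 < 1 + nm l + nm m by rewrite -addrA ltr_wpDr // addr_ge0.
have d0 : 0 < d by rewrite lt_min ltr01 divr_gt0.
have [N HN] := ul _ d0; have [K HK] := vm _ d0.
exists (maxn N K) => k; rewrite geq_max => /andP[/HN h1 /HK h2].
have -> : u k * v k - l * m =
  (u k - l) * (v k - m) + ((u k - l) * m + l * (v k - m)) by ring.
have : d * (1 + nm l + nm m) <= e by rewrite -ler_pdivlMr // ge_min lexx orbT.
apply: lt_le_trans.
apply: le_lt_trans (nmD _ _) _; rewrite -[1 + _ + _]addrA [d * _]mulrDr mulr1.
apply: ltr_leD.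
  rewrite nmM; have d1 : d <= 1 by rewrite ge_min lexx.
  apply: le_lt_trans h1; apply: ler_piMr => //.
  by apply/ltW/(lt_le_trans h2).
apply: le_trans (nmD _ _) _; rewrite !nmM [d * _]mulrDr addrC [d * nm l]mulrC.
by apply: lerD; [apply: ler_wpM2l|apply: ler_wpM2r] => //; apply: ltW.
Qed.

Lemma clim_uniq u l m : clim u l -> clim u m -> l = m.
Proof.
move=> ul um; apply/eqP; rewrite -subr_eq0 -nm_eq0 eq_le nm_ge0 andbT.
apply/ler_addgt0Pr => e e0; rewrite add0r; have e2 : 0 < e / 2 by rewrite divr_gt0.
have [N HN] := ul _ e2; have [K HK] := um _ e2.
have -> : l - m = (u (maxn N K) - m) - (u (maxn N K) - l) by ring.
apply: le_trans (nmB _ _) _; rewrite (splitr e); apply: lerD; apply: ltW.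
  by apply: HK; rewrite leq_maxr.
by apply: HN; rewrite leq_maxl.
Qed.

Lemma clim_const l : clim (fun=> l) l.
Proof. by move=> e e0; exists 0%N => k _; rewrite subrr nm0. Qed.

Lemma complete_C u :
  (forall e : R, 0 < e -> exists N, forall j k, (N <= j)%N -> (j <= k)%N ->
     nm (u k - u j) < e) -> exists l, clim u l.
Proof.
move=> cu.
(* Completeness is borrowed from [R] through the 1-Lipschitz functions [Re] and [Im]. *)
have cauchyR (f : R[i] -> R) : (forall z w, `|f z - f w| <= nm (z - w)) ->
    exists l : R, forall e : R, 0 < e ->
      exists N, forall k, (N <= k)%N -> `|f (u k) - l| < e.
  move=> fl; have : cvg ((f (u k) : R) @[k --> \oo]).
    apply/cauchy_cvgP/cauchy_exP => e e0; have [N HN] := cu _ e0.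
    exists (f (u N)); exists N => // k /= Nk; rewrite /ball /= distrC.
    by apply: le_lt_trans (fl _ _) _; apply: HN.
  move=> /cvgrPdist_lt fc; exists (lim ((f (u k) : R) @[k --> \oo])) => e e0.
  have [N _ HN] := fc _ e0; exists N => k Nk; rewrite distrC; exact: HN.
have [z w|a Ha] := cauchyR (fun z => complex.Re z).
  by case: z w => a b [c d]; rewrite -[a - c]/(complex.Re ((a +i* b) - (c +i* d))) nm_Re.
have [z w|b Hb] := cauchyR (fun z => complex.Im z).
  by case: z w => x y [c d]; rewrite -[y - d]/(complex.Im ((x +i* y) - (c +i* d))) nm_Im.
exists (a +i* b) => e e0; have e2 : 0 < e / 2 by rewrite divr_gt0.
have [N HN] := Ha _ e2; have [K HK] := Hb _ e2.
exists (maxn N K) => k; rewrite geq_max => /andP[/HN h1 /HK h2].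
apply: le_lt_trans (nm_le _) _; rewrite (splitr e).
by move: h1 h2; case: (u k) => x y /= h1 h2; apply: ltrD.
Qed.

Lemma mono_cauchy (T : nat -> R) (M : R) :
  {homo T : j k / (j <= k)%N >-> j <= k} -> (forall k, T k <= M) ->
  forall e : R, 0 < e -> exists N, forall j k, (N <= j)%N -> (j <= k)%N ->
    T k - T j < e.
Proof.
move=> Tm TM e e0.
have Tc : cvg ((T k : R) @[k --> \oo]).
  by apply: nondecreasing_is_cvgn => //; exists M => _ [k _ <-].
have /cvgrPdist_lt Tl := Tc.
have e2 : 0 < e / 2 by rewrite divr_gt0.
have [N _ HN] := Tl _ e2; exists N => j k Nj jk.
have h1 := HN j Nj; have h2 := HN k (leq_trans Nj jk).
rewrite /= in h1 h2; apply: le_lt_trans (ler_norm _) _.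
have -> : T k - T j = (limn T - T j) - (limn T - T k) by ring.
by apply: le_lt_trans (ler_normB _ _) _; rewrite (splitr e) ltrD.
Qed.

(** The form of absolute convergence used below: [T] is a partial sum of moduli, or minus a
    geometric tail. *)
Lemma complete_mono u (T : nat -> R) (M : R) :
  (forall j k, (j <= k)%N -> nm (u k - u j) <= T k - T j) ->
  (forall k, T k <= M) -> exists l, clim u l.
Proof.
move=> uT TM; apply: complete_C => e e0.
have Tm : {homo T : j k / (j <= k)%N >-> j <= k}.
  by move=> j k /uT h; rewrite -subr_ge0 (le_trans _ h).
have [N HN] := mono_cauchy Tm TM e0; exists N => j k Nj jk.
by apply: le_lt_trans (uT _ _ jk) _; apply: HN.
Qed.

Lemma small_geo (c e : R) : 0 <= c -> 0 < e ->
  exists N, forall k, (N <= k)%N -> c / 2 ^+ k < e.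
Proof.
move=> c0 e0; have c1 : 0 < e / (c + 1) by rewrite divr_gt0 // ltr_wpDl.
have [N _ HN] := @near_infty_natSinv_expn_lt R (PosNum c1); exists N => k /HN /=.
rewrite div1r ltr_pdivlMr ?ltr_wpDl // mulrC; apply: le_lt_trans.
by rewrite ler_wpM2r ?invr_ge0 ?exprn_ge0 // lerDl.
Qed.

End Modulus.
#[global] Hint Extern 0 (is_true (@Order.le _ _ _ (nm _))) => exact: nm_ge0 : core.

(** * Convergent power series *)

Lemma big_sub_split (V : nmodType) (T : eqType) (s1 s2 : seq T) (F : T -> V) :
  uniq s1 -> uniq s2 -> {subset s1 <= s2} ->
  \sum_(m <- s2) F m = \sum_(m <- s1) F m + \sum_(m <- s2 | m \notin s1) F m.
Proof.
move=> u1 u2 s12; rewrite (bigID (mem s1)) /=; congr (_ + _).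
rewrite -big_filter; apply: perm_big; apply: uniq_perm; rewrite ?filter_uniq//.
by move=> m; rewrite mem_filter /=; case: (boolP (m \in s1)) => // /s12.
Qed.

Lemma ler_sum_sub (K : numDomainType) (T : eqType) (s1 s2 : seq T) (F : T -> K) :
  uniq s1 -> uniq s2 -> {subset s1 <= s2} -> (forall m, 0 <= F m) ->
  \sum_(m <- s1) F m <= \sum_(m <- s2) F m.
Proof.
by move=> u1 u2 s12 F0; rewrite (big_sub_split _ u1 u2 s12) lerDl sumr_ge0.
Qed.

Section Boxes.
Variable n : nat.
Implicit Types (m k l : multi_index n) (N : nat).

(** Boxes as duplicate-free lists over one fixed type, so that sums over boxes of different sizes
    can be compared. *)
Definition bx N : seq (multi_index n) :=
  [seq ([ffun i => nat_of_ord (m i)] : multi_index n) | m : {ffun 'I_n -> 'I_N}].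

Lemma mem_bx N m : (m \in bx N) = [forall i, (m i < N)%N].
Proof.
apply/fintype.imageP/forallP => [[p _ ->] i|h]; first by rewrite ffunE.
exists [ffun i => Ordinal (h i)] => //.
by apply/ffunP => i; rewrite !ffunE.
Qed.

Lemma bx_uniq N : uniq (bx N).
Proof.
rewrite map_inj_uniq ?enum_uniq // => p q /ffunP pq; apply/ffunP => i.
by apply: val_inj; move: (pq i); rewrite !ffunE.
Qed.

Lemma bx_sub N N' : (N <= N')%N -> {subset bx N <= bx N'}.
Proof.
move=> NN m; rewrite !mem_bx => /forallP h; apply/forallP => i.
exact: leq_trans (h i) NN.
Qed.

Lemma big_bx (V : nmodType) N (G : multi_index n -> V) :
  \sum_(m : {ffun 'I_n -> 'I_N}) G [ffun i => nat_of_ord (m i)]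
  = \sum_(m <- bx N) G m.
Proof. by rewrite big_image. Qed.

Lemma mi_le_deg m i : (m i <= mi_deg m)%N.
Proof. by rewrite /mi_deg (bigD1 i) //= leq_addr. Qed.

Lemma mem_bx_deg m N : (mi_deg m < N)%N -> m \in bx N.
Proof.
move=> h; rewrite mem_bx; apply/forallP => i.
exact: leq_ltn_trans (mi_le_deg m i) h.
Qed.

Definition mle k m := [forall i, (k i <= m i)%N].
Definition madd k l : multi_index n := [ffun i => (k i + l i)%N].
Definition msub m k : multi_index n := [ffun i => (m i - k i)%N].

Lemma mi_deg_add k l : mi_deg (madd k l) = (mi_deg k + mi_deg l)%N.
Proof. by rewrite /mi_deg -big_split; apply: eq_bigr => i _; rewrite ffunE. Qed.

Lemma maddK k m : mle k m -> madd k (msub m k) = m.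
Proof.
by move=> /forallP km; apply/ffunP => i; rewrite !ffunE subnKC.
Qed.

Lemma msubK k l : msub (madd k l) k = l.
Proof. by apply/ffunP => i; rewrite !ffunE addKn. Qed.

Lemma mle_add k l : mle k (madd k l).
Proof. by apply/forallP => i; rewrite ffunE leq_addr. Qed.

Lemma mle_bx k m N : mle k m -> m \in bx N -> k \in bx N.
Proof.
rewrite !mem_bx => /forallP km /forallP mN; apply/forallP => i.
exact: leq_ltn_trans (km i) (mN i).
Qed.

(** A box that contains [m] contains every divisor of [m], so the box chosen in a Cauchy product
    does not matter. *)
Lemma big_mle (V : nmodType) m N (G : multi_index n -> V) : m \in bx N ->
  \sum_(k <- bx (mi_deg m).+1 | mle k m) G k = \sum_(k <- bx N | mle k m) G k.
Proof.
move=> mN; rewrite -!(big_filter (bx _)); apply: perm_big.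
apply: uniq_perm; rewrite ?filter_uniq ?bx_uniq // => k; rewrite !mem_filter.
case: (boolP (mle k m)) => //= km; rewrite (mle_bx km mN).
by rewrite (mle_bx km) // mem_bx_deg.
Qed.

Lemma big_mle_add (V : nmodType) N k (G : multi_index n -> V) : k \in bx N ->
  \sum_(m <- bx N | mle k m) G m = \sum_(l <- bx N | madd k l \in bx N) G (madd k l).
Proof.
move=> kN; rewrite -(big_filter _ (mle k)) -(big_filter _ (fun l => _ \in _)).
rewrite -(big_map (madd k) xpredT); apply: perm_big.
apply: uniq_perm; rewrite ?filter_uniq ?bx_uniq //.
  rewrite map_inj_uniq ?filter_uniq ?bx_uniq // => l l' e.
  by rewrite -(msubK k l) e msubK.
move=> m; rewrite mem_filter; apply/andP/mapP => [[km mN]|[l]].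
  exists (msub m k); last by rewrite maddK.
  rewrite mem_filter maddK // mN /=; move: mN; rewrite !mem_bx => /forallP mN.
  by apply/forallP => i; rewrite ffunE (leq_ltn_trans (leq_subr _ _)).
by rewrite mem_filter => /andP[h _] ->; split => //; exact: mle_add.
Qed.

End Boxes.

Section Series.
Variables (R : realType) (n : nat).
Implicit Types (a b : multi_index n -> R[i]) (x : Cspace R n) (r M : R).

Definition mon x (m : multi_index n) : R[i] := \prod_i (x 0 i : R[i]) ^+ m i.

Lemma mon_add x k l : mon x (madd k l) = mon x k * mon x l.
Proof.
by rewrite /mon -big_split; apply: eq_bigr => i _; rewrite ffunE exprD.
Qed.

Definition in_pd (r : R) x := forall i, nm (x 0 i) <= r.

Lemma nm_mon x m r : in_pd r x -> nm (mon x m) <= r ^+ mi_deg m.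
Proof.
move=> xr; rewrite nm_prod /mi_deg -prodrXr; apply: ler_prod => i _.
rewrite nm_ge0 nmX /=; apply: lerXn2r; rewrite ?nnegrE ?nm_ge0 //.
exact: le_trans (nm_ge0 _) (xr i).
Qed.

Definition psum a x N : R[i] := \sum_(m <- bx n N) a m * mon x m.

Lemma ps_partialE a x N : ps_partial a x N = psum a x N.
Proof.
rewrite /psum -big_bx; apply: eq_bigr => m _; congr (_ * _).
by apply: eq_bigr => i _; rewrite ffunE.
Qed.

Definition asum a r N : R := \sum_(m <- bx n N) nm (a m) * r ^+ mi_deg m.

(** The norm [sum_m |a_m| r^|m|] is at most [M], said through partial sums so that the infinite sum
    is never formed. For this norm the series form a Banach algebra. *)
Definition nle a r M := forall N, asum a r N <= M.

Lemma asum_ge0 a r N : 0 <= r -> 0 <= asum a r N.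
Proof. by move=> r0; apply: sumr_ge0 => m _; rewrite mulr_ge0 // exprn_ge0. Qed.

Lemma asum_mono a r N N' : 0 <= r -> (N <= N')%N -> asum a r N <= asum a r N'.
Proof.
move=> r0 NN; apply: ler_sum_sub; rewrite ?bx_uniq //; first exact: bx_sub.
by move=> m; rewrite mulr_ge0 // exprn_ge0.
Qed.

Lemma nle_ge0 a r M : 0 <= r -> nle a r M -> 0 <= M.
Proof. by move=> r0 /(_ 0%N); apply: le_trans; exact: asum_ge0. Qed.

Lemma nle_coef a r M m : 0 <= r -> nle a r M -> nm (a m) * r ^+ mi_deg m <= M.
Proof.
move=> r0 /(_ (mi_deg m).+1); apply: le_trans.
rewrite /asum (bigD1_seq m) ?bx_uniq ?mem_bx_deg //= lerDl sumr_ge0 // => k _.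
by rewrite mulr_ge0 // exprn_ge0.
Qed.

Lemma nle_mono a r M M' : M <= M' -> nle a r M -> nle a r M'.
Proof. by move=> MM h N; apply: le_trans (h N) MM. Qed.

Lemma nle_shrink a r s M : 0 <= s -> s <= r -> nle a r M -> nle a s M.
Proof.
move=> s0 sr h N; apply: le_trans (h N); apply: ler_sum => m _.
by apply: ler_wpM2l => //; rewrite lerXn2r ?nnegrE // (le_trans s0).
Qed.

(** Every remaining monomial has degree at least 1, so passing from [r] to [s] gains a factor
    [s / r] on each. *)
Lemma nle_small a r s M : a [ffun=> 0%N] = 0 -> 0 <= s -> s <= r -> 0 < r ->
  nle a r M -> nle a s (s / r * M).
Proof.
move=> a0 s0 sr r0 h N; have h1 := h N.
have : asum a s N <= s / r * asum a r N.
  rewrite /asum mulr_sumr; apply: ler_sum => m _.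
  have [->|mn0] := eqVneq m [ffun=> 0%N].
    by rewrite a0 nm0 !mul0r mulr0.
  have dm : (0 < mi_deg m)%N.
    rewrite lt0n; apply: contraNneq mn0 => d0; apply/eqP/ffunP => i.
    by apply/eqP; rewrite ffunE -leqn0 -d0 mi_le_deg.
  rewrite mulrCA; apply: ler_wpM2l => //.
  rewrite -[mi_deg m]prednK // !exprS mulrA divfK ?gt_eqF //.
  by apply: ler_wpM2l => //; rewrite lerXn2r ?nnegrE // (le_trans s0).
move/le_trans; apply; apply: ler_wpM2l => //.
by rewrite divr_ge0 // (le_trans s0).
Qed.

Lemma convergentP a :
  convergent a <-> exists2 r, 0 < r & exists M, nle a r M.
Proof.
have tE r m : 0 < r -> (`|(nm (a m) * r ^+ mi_deg m)%:E| = (nm (a m) * r ^+ mi_deg m)%:E)%E.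
  by move=> r0; rewrite gee0_abs // lee_fin mulr_ge0 // exprn_ge0 // ltW.
split=> [[r r0 sa]|[r r0 [M h]]]; exists r => //.
  have fin : (\esum_(m in [set: multi_index n])
      `|(nm (a m) * r ^+ mi_deg m)%:E| \is a fin_num)%E.
    by rewrite -summableE.
  exists (fine (\esum_(m in [set: multi_index n])
      `|(nm (a m) * r ^+ mi_deg m)%:E|)%E) => N.
  rewrite -lee_fin fineK //; apply: esum_ge; exists [set` bx n N].
    by split=> //; exact: finite_seq.
  rewrite -fsbig_seq ?bx_uniq // -sumEFin; apply: lee_sum => m _.
  by rewrite tE.
apply: (@le_lt_trans _ _ M%:E); last exact: ltry.
apply: ge_ereal_sup => _ [A [fA _] <-].
rewrite (eq_fsbigr (fun m => (nm (a m) * r ^+ mi_deg m)%:E)); last first.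
  by move=> m _; rewrite tE.
rewrite fsbig_finite //= sumEFin lee_fin.
(* A finite set of indices lies in the box whose side exceeds all their degrees. *)
apply: le_trans (h (\max_(m <- finmap.enum_fset (fset_set A)) mi_deg m).+1).
apply: ler_sum_sub; rewrite ?bx_uniq ?finmap.fset_uniq //.
  move=> m mA; rewrite mem_bx_deg // ltnS.
  by rewrite (big_rem _ mA) /= leq_maxl.
by move=> m; rewrite mulr_ge0 // exprn_ge0 // ltW.
Qed.

Lemma psum_cauchy a x r j k : in_pd r x -> 0 <= r -> (j <= k)%N ->
  nm (psum a x k - psum a x j) <= asum a r k - asum a r j.
Proof.
move=> xr r0 jk; have sub := @bx_sub n _ _ jk.
rewrite /psum /asum !(big_sub_split _ (bx_uniq n j) (bx_uniq n k) sub).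
rewrite [X in nm X]addrAC [leRHS]addrAC !subrr !add0r.
apply: le_trans (nm_sum _ _ _) _; apply: ler_sum => m _.
by rewrite nmM ler_wpM2l // nm_mon.
Qed.

Lemma ps_eval_clim a x r M : 0 <= r -> nle a r M -> in_pd r x ->
  clim (psum a x) (ps_eval a x).
Proof.
move=> r0 h xr.
have [l al] : exists l, clim (psum a x) l.
  apply: (@complete_mono _ _ (asum a r) M) => // j k jk; exact: psum_cauchy.
suff -> : ps_eval a x = l by [].
rewrite /ps_eval; have -> : ps_partial a x = psum a x.
  by apply/funext => N; rewrite ps_partialE.
exact: clim_lim.
Qed.

Lemma nm_psum a x r M N : 0 <= r -> nle a r M -> in_pd r x -> nm (psum a x N) <= M.
Proof.
move=> r0 h xr; apply: le_trans (h N); apply: le_trans (nm_sum _ _ _) _.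
by apply: ler_sum => m _; rewrite nmM ler_wpM2l // nm_mon.
Qed.

Lemma nm_ps_eval a x r M : 0 <= r -> nle a r M -> in_pd r x -> nm (ps_eval a x) <= M.
Proof.
move=> r0 h xr; apply: (clim_nm_le (N := 0) (ps_eval_clim r0 h xr)) => k _.
exact: nm_psum h xr.
Qed.

Lemma ps_evalE a x r M l : 0 <= r -> nle a r M -> in_pd r x ->
  clim (psum a x) l -> ps_eval a x = l.
Proof. by move=> r0 h xr; apply: clim_uniq; exact: ps_eval_clim h xr. Qed.

Definition sadd a b : multi_index n -> R[i] := fun m => a m + b m.
Definition sscale (c : R[i]) a : multi_index n -> R[i] := fun m => c * a m.
Definition sX (c : R[i]) (k : multi_index n) : multi_index n -> R[i] :=
  fun m => if m == k then c else 0.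
(** The Cauchy product, summed over a list instead of the dependent function type of [ps_mul], so
    that sums can be exchanged. *)
Definition conv a b : multi_index n -> R[i] :=
  fun m => \sum_(k <- bx n (mi_deg m).+1 | mle k m) a k * b (msub m k).

Lemma nle_add a b r M M' : 0 <= r ->
  nle a r M -> nle b r M' -> nle (sadd a b) r (M + M').
Proof.
move=> r0 ha hb N; apply: le_trans (lerD (ha N) (hb N)).
rewrite -big_split /=; apply: ler_sum => m _; rewrite -mulrDl ler_wpM2r //.
  by rewrite exprn_ge0.
exact: nmD.
Qed.

Lemma nle_scale c a r M : nle a r M -> nle (sscale c a) r (nm c * M).
Proof.
move=> ha N; apply: le_trans (ler_wpM2l (nm_ge0 c) (ha N)).
by rewrite mulr_sumr; apply: ler_sum => m _; rewrite nmM mulrA.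
Qed.

Lemma nle_sX c k r : 0 <= r -> nle (sX c k) r (nm c * r ^+ mi_deg k).
Proof.
move=> r0 N; have [kN|kN] := boolP (k \in bx n N).
  rewrite /asum (bigD1_seq k) ?bx_uniq //= big1 => [|m mk].
    by rewrite addr0 /sX eqxx.
  by rewrite /sX (negPf mk) nm0 mul0r.
rewrite /asum big_seq big1 ?mulr_ge0 ?exprn_ge0 // => m mN.
by rewrite /sX (_ : (m == k) = false) ?nm0 ?mul0r //; apply: contraNF kN => /eqP <-.
Qed.

Lemma sum_conv (V : nmodType) (G : multi_index n -> multi_index n -> V) N :
  \sum_(m <- bx n N) \sum_(k <- bx n (mi_deg m).+1 | mle k m) G k (msub m k)
  = \sum_(k <- bx n N) \sum_(l <- bx n N | madd k l \in bx n N) G k l.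
Proof.
rewrite big_seq; under eq_bigr => m mN do rewrite (big_mle _ mN).
rewrite -big_seq (exchange_big_dep predT) //= big_seq [RHS]big_seq.
apply: eq_bigr => k kN; rewrite (big_mle_add _ kN).
by apply: eq_bigr => l _; rewrite msubK.
Qed.

Lemma psum_conv a b x N : psum (conv a b) x N =
  \sum_(k <- bx n N) \sum_(l <- bx n N | madd k l \in bx n N)
     (a k * mon x k) * (b l * mon x l).
Proof.
rewrite -(sum_conv (fun k l => (a k * mon x k) * (b l * mon x l))).
apply: eq_bigr => m _; rewrite mulr_suml; apply: eq_bigr => k km.
by rewrite -{2}(maddK km) mon_add; ring.
Qed.

End Series.

Section Eval.
Variables (R : realType) (n : nat).
Implicit Types (a b : multi_index n -> R[i]) (x : Cspace R n) (r M : R).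

Lemma nle_conv a b r M M' : 0 <= r ->
  nle a r M -> nle b r M' -> nle (conv a b) r (M * M').
Proof.
move=> r0 ha hb N.
pose g k l : R := nm (a k) * r ^+ mi_deg k * (nm (b l) * r ^+ mi_deg l).
have g0 k l : 0 <= g k l by rewrite !mulr_ge0 // exprn_ge0.
apply: le_trans (ler_pM (asum_ge0 a N r0) (asum_ge0 b N r0) (ha N) (hb N)).
apply: (@le_trans _ _ (\sum_(k <- bx n N) \sum_(l <- bx n N | madd k l \in bx n N) g k l)).
  rewrite -(sum_conv g); apply: ler_sum => m _.
  apply: le_trans (ler_wpM2r (exprn_ge0 _ r0) (nm_sum _ _ _)) _.
  rewrite mulr_suml; apply: ler_sum => k km.
  by rewrite -{2}(maddK km) mi_deg_add exprD nmM /g mulrACA.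
rewrite /asum mulr_suml; apply: ler_sum => k _.
rewrite mulr_sumr [leRHS](bigID (fun l => madd k l \in bx n N)) /= lerDl.
by apply: sumr_ge0 => l _; exact: g0.
Qed.

(** The partial sum of the product misses the pairs [(k, l)] with [k + l] outside the box. Such [k]
    and [l] are not both in the box of half the side, so the missing terms add up to at most
    [T N - T N./2], which tends to 0 because [T] is monotone and bounded. *)
Lemma psum_conv_clim a b x r M M' : 0 <= r -> nle a r M -> nle b r M' ->
  in_pd r x -> clim (psum (conv a b) x) (ps_eval a x * ps_eval b x).
Proof.
move=> r0 ha hb xr.
pose T N := asum a r N * asum b r N.
have Tm : {homo T : j k / (j <= k)%N >-> j <= k}.
  by move=> j k jk; apply: ler_pM; rewrite ?asum_ge0 ?asum_mono.
have TM k : T k <= M * M' by apply: ler_pM; rewrite ?asum_ge0.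
have dlim : clim (fun N => psum (conv a b) x N - psum a x N * psum b x N) 0.
  apply: (clim_sqz (v := fun N => T N - T N./2)) => [N|e e0]; last first.
    have [N HN] := mono_cauchy Tm TM e0; exists N.*2 => k Nk; apply: HN.
      by rewrite -(doubleK N) half_leq.
    lia.
  pose g k l : R := nm (a k) * r ^+ mi_deg k * (nm (b l) * r ^+ mi_deg l).
  have g0 k l : 0 <= g k l by rewrite !mulr_ge0 // exprn_ge0.
  pose c k l := (a k * mon x k) * (b l * mon x l).
  have cg k l : nm (c k l) <= g k l.
    rewrite !nmM; apply: ler_pM; rewrite ?mulr_ge0 //;
    by apply: ler_wpM2l => //; apply: nm_mon.
  have -> : psum (conv a b) x N - psum a x N * psum b x N =
    - \sum_(k <- bx n N) \sum_(l <- bx n N | madd k l \notin bx n N) c k l.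
    rewrite psum_conv /psum mulr_suml -sumrB -sumrN; apply: eq_bigr => k _.
    rewrite mulr_sumr [X in _ - X](bigID (fun l => madd k l \in bx n N)) /=.
    by rewrite opprD addrA subrr add0r.
  rewrite subr0 nmN; apply: le_trans (nm_sum _ _ _) _.
  apply: (@le_trans _ _
    (\sum_(k <- bx n N) \sum_(l <- bx n N | madd k l \notin bx n N) g k l)).
    by apply: ler_sum => k _; apply: le_trans (nm_sum _ _ _) _; apply: ler_sum.
  rewrite lerBrDr -lerBrDl.
  have -> : T N - \sum_(k <- bx n N) \sum_(l <- bx n N | madd k l \notin bx n N) g k l
     = \sum_(k <- bx n N) \sum_(l <- bx n N | madd k l \in bx n N) g k l.
    rewrite /T /asum mulr_suml -sumrB; apply: eq_bigr => k _.
    rewrite mulr_sumr (bigID (fun l => madd k l \in bx n N)) /=.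
    by rewrite addrK.
  have hN : (N./2 <= N)%N by lia.
  rewrite /T /asum mulr_suml.
  apply: (@le_trans _ _ (\sum_(k <- bx n N./2)
      \sum_(l <- bx n N | madd k l \in bx n N) g k l)); last first.
    apply: ler_sum_sub; rewrite ?bx_uniq //; first exact: bx_sub.
    by move=> k; rewrite sumr_ge0.
  rewrite big_seq [leRHS]big_seq; apply: ler_sum => k kh.
  rewrite mulr_sumr -[leRHS]big_filter; apply: ler_sum_sub => //.
  - exact: bx_uniq.
  - by rewrite filter_uniq ?bx_uniq.
  - move=> l lh; rewrite mem_filter (bx_sub hN lh) andbT.
    move: kh lh; rewrite !mem_bx => /forallP kh /forallP lh; apply/forallP => i.
    by rewrite ffunE; have := kh i; have := lh i; lia.
  - by move=> l; exact: g0.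
have := climD dlim (climM (ps_eval_clim r0 ha xr) (ps_eval_clim r0 hb xr)).
by rewrite add0r; apply: clim_ext => N; rewrite subrK.
Qed.

Lemma ps_eval_conv a b x r M M' : 0 <= r -> nle a r M -> nle b r M' ->
  in_pd r x -> ps_eval (conv a b) x = ps_eval a x * ps_eval b x.
Proof.
move=> r0 ha hb xr; apply: (ps_evalE r0 (nle_conv r0 ha hb) xr).
exact: psum_conv_clim ha hb xr.
Qed.

Lemma ps_eval_add a b x r M M' : 0 <= r -> nle a r M -> nle b r M' ->
  in_pd r x -> ps_eval (sadd a b) x = ps_eval a x + ps_eval b x.
Proof.
move=> r0 ha hb xr; apply: (ps_evalE r0 (nle_add r0 ha hb) xr).
apply: clim_ext (climD (ps_eval_clim r0 ha xr) (ps_eval_clim r0 hb xr)) => N.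
by rewrite /psum -big_split; apply: eq_bigr => m _; rewrite mulrDl.
Qed.

Lemma ps_eval_scale c a x r M : 0 <= r -> nle a r M ->
  in_pd r x -> ps_eval (sscale c a) x = c * ps_eval a x.
Proof.
move=> r0 ha xr; apply: (ps_evalE r0 (nle_scale c ha) xr).
apply: clim_ext (climM (clim_const c) (ps_eval_clim r0 ha xr)) => N.
by rewrite /psum mulr_sumr; apply: eq_bigr => m _; rewrite mulrA.
Qed.

Lemma ps_eval_sX c k x : ps_eval (sX c k) x = c * mon x k.
Proof.
(* A monomial converges everywhere, so the radius may be fitted to [x]. *)
pose r := \big[Num.max/0]_i nm (x 0 i : R[i]).
have xr : in_pd r x by move=> i; apply: (le_bigmax _ (fun i => nm (x 0 i : R[i]))).
have r0 : 0 <= r by rewrite /r; elim/big_ind: _ => // u v u0 v0; rewrite le_max u0.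
apply: (ps_evalE r0 (nle_sX c k r0) xr) => e e0; exists (mi_deg k).+1 => N kN.
rewrite /psum (bigD1_seq k) ?bx_uniq ?mem_bx_deg //= big1 => [|m mk].
  by rewrite addr0 /sX eqxx subrr nm0.
by rewrite /sX (negPf mk) mul0r.
Qed.

Definition mi0 : multi_index n := [ffun=> 0%N].
Definition mi1 (i : 'I_n) : multi_index n := [ffun j => (j == i : nat)].

Lemma mon_mi0 x : mon x mi0 = 1.
Proof. by rewrite /mon big1 // => i _; rewrite ffunE expr0. Qed.

Lemma mon_mi1 x i : mon x (mi1 i) = x 0 i.
Proof.
rewrite /mon (bigD1 i) //= big1 => [|j ji]; first by rewrite ffunE eqxx mulr1.
by rewrite ffunE (negPf ji).
Qed.

Lemma mi_deg0 : mi_deg mi0 = 0%N.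
Proof. by rewrite /mi_deg big1 // => i _; rewrite ffunE. Qed.

(** The neighbourhood filter of 0 (see [near0P]) in terms of polydiscs of real radius, on which the
    norm estimates hold. *)
Definition near0 (P : Cspace R n -> Prop) :=
  exists2 e : R, 0 < e & forall x, in_pd e x -> P x.

Lemma near0_and P Q : near0 P -> near0 Q -> near0 (fun x => P x /\ Q x).
Proof.
move=> [e e0 hP] [d d0 hQ]; exists (Num.min e d); first by rewrite lt_min e0.
move=> x xr; split; [apply: hP|apply: hQ] => i; apply: le_trans (xr i) _;
by rewrite ge_min lexx ?orbT.
Qed.

Lemma near0_imp (P Q : Cspace R n -> Prop) :
  (forall x, P x -> Q x) -> near0 P -> near0 Q.
Proof. by move=> PQ [e e0 hP]; exists e => // x /hP/PQ. Qed.

Lemma near0_all (P : Cspace R n -> Prop) : (forall x, P x) -> near0 P.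
Proof. by move=> hP; exists 1. Qed.

Lemma near0_ball (P : Cspace R n -> Prop) (e : R) : 0 < e -> near0 P ->
  exists2 d : R, 0 < d <= e & forall x, in_pd d x -> P x.
Proof.
move=> e0 [d d0 hP]; exists (Num.min d e).
  by rewrite lt_min d0 e0 /= ge_min lexx orbT.
by move=> x xr; apply: hP => i; apply: le_trans (xr i) _; rewrite ge_min lexx.
Qed.

Lemma near0_forall (I : finType) (P : I -> Cspace R n -> Prop) :
  (forall i, near0 (P i)) -> near0 (fun x => forall i, P i x).
Proof.
move=> h; suff : forall s : seq I, near0 (fun x => forall i, i \in s -> P i x).
  by move=> /(_ (enum I)); apply: near0_imp => x hx i; apply: hx; rewrite mem_enum.
elim=> [|i s IH]; first exact: near0_all.
apply: near0_imp (near0_and (h i) IH) => x [Pi Ps] j.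
by rewrite inE => /orP[/eqP ->|/Ps].
Qed.

Lemma near0P (P : Cspace R n -> Prop) :
  (\forall x \near (0 : 'rV[R[i]^o]_n), P x) <-> near0 P.
Proof.
split=> [/nbhs_ballP[e /= e0 he]|[e e0 he]].
  have er : e = (complex.Re e)%:C.
    by case: e e0 {he} => a b; rewrite ltcE /= => /andP[/eqP ->].
  have re0 : 0 < complex.Re e by rewrite -ltcR -er.
  (* Half the radius, because [in_pd] is closed and the ball is open. *)
  exists (complex.Re e / 2); first by rewrite divr_gt0.
  move=> x xr; apply: he; split=> // i j; rewrite ord1 mxE /ball /= sub0r normrN er.
  rewrite nmE ltcR; apply: le_lt_trans (xr j) _.
  by rewrite ltr_pdivrMr // ltr_pMr // ltr1n.
apply/nbhs_ballP; exists e%:C => /=; first by rewrite ltcR.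
move=> x [_ xr]; apply: he => i; have := xr 0 i.
by rewrite mxE /ball /= sub0r normrN nmE ltcR => /ltW.
Qed.

End Eval.

(** * Germs of analytic functions *)

Section Analytic.
Variables (R : realType) (n : nat).
Implicit Types (a b : multi_index n -> R[i]) (x : Cspace R n) (r M : R).
Implicit Types (f g : Cspace R n -> R[i]).

(** A property of functions rather than of series: algebra is then done pointwise, and the values
    away from 0 are free. *)
Definition anal f := exists2 a : Defs.pseries R n,
  convergent a & near0 (fun x => f x = ps_eval a x).

Lemma anal_nle f (e : R) : anal f -> 0 < e -> exists a r M,
  [/\ 0 < r <= e, nle a r M & forall x, in_pd r x -> f x = ps_eval a x].
Proof.
move=> [a /convergentP[r r0 [M hM]] fa] e0.
have er0 : 0 < Num.min e r by rewrite lt_min e0.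
have [d /andP[d0]] := near0_ball er0 fa; rewrite le_min => /andP[de dr] hd.
exists a, d, M; split=> //; first by rewrite d0.
exact: nle_shrink (ltW d0) dr hM.
Qed.

Lemma nle_anal f a r M : 0 < r -> nle a r M ->
  (forall x, in_pd r x -> f x = ps_eval a x) -> anal f.
Proof.
move=> r0 h fa; exists a; last by exists r.
by apply/convergentP; exists r => //; exists M.
Qed.

Lemma anal_near f g : near0 (fun x => f x = g x) -> anal f -> anal g.
Proof.
move=> fg [a ca fa]; exists a => //.
by apply: near0_imp (near0_and fg fa) => x [<- <-].
Qed.

Lemma anal_ext f g : f =1 g -> anal f -> anal g.
Proof. by move=> fg; apply: anal_near; exact: near0_all. Qed.

Lemma anal_cst (c : R[i]) : anal (fun=> c).
Proof.
apply: (@nle_anal _ (sX c (mi0 n)) 1 _ ltr01 (nle_sX _ _ ler01)) => x _.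
by rewrite ps_eval_sX mon_mi0 mulr1.
Qed.

Lemma anal_coord i : anal (fun x => x 0 i).
Proof.
apply: (@nle_anal _ (sX 1 (mi1 i)) 1 _ ltr01 (nle_sX _ _ ler01)) => x _.
by rewrite ps_eval_sX mon_mi1 mul1r.
Qed.

Lemma anal2 f g : anal f -> anal g -> exists a b r M,
  [/\ 0 < r, nle a r M, nle b r M &
      forall x, in_pd r x -> f x = ps_eval a x /\ g x = ps_eval b x].
Proof.
move=> /anal_nle/(_ ltr01)[a [r [M [/andP[r0 _] aM fa]]]] /anal_nle/(_ r0).
move=> [b [s [M' [/andP[s0 sr] bM gb]]]].
exists a, b, s, (Num.max M M'); split=> //.
- by apply: nle_mono (nle_shrink (ltW s0) sr aM); rewrite le_max lexx.
- by apply: nle_mono bM; rewrite le_max lexx orbT.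
- move=> x xs; split; last exact: gb.
  by apply: fa => i; apply: le_trans (xs i) sr.
Qed.

Lemma analD f g : anal f -> anal g -> anal (fun x => f x + g x).
Proof.
move=> /anal2 h /h[a [b [r [M [r0 aM bM fg]]]]].
apply: (nle_anal r0 (nle_add (ltW r0) aM bM)) => x xr.
by rewrite (ps_eval_add (ltW r0) aM bM xr); have [-> ->] := fg x xr.
Qed.

Lemma analM f g : anal f -> anal g -> anal (fun x => f x * g x).
Proof.
move=> /anal2 h /h[a [b [r [M [r0 aM bM fg]]]]].
apply: (nle_anal r0 (nle_conv (ltW r0) aM bM)) => x xr.
by rewrite (ps_eval_conv (ltW r0) aM bM xr); have [-> ->] := fg x xr.
Qed.

Lemma analN f : anal f -> anal (fun x => - f x).
Proof.
by move=> fa; apply: anal_ext (analM (anal_cst (-1)) fa) => x; rewrite mulN1r.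
Qed.

Lemma analB f g : anal f -> anal g -> anal (fun x => f x - g x).
Proof. by move=> fa ga; apply: analD => //; apply: analN. Qed.

Lemma analX f k : anal f -> anal (fun x => f x ^+ k).
Proof.
move=> fa; elim: k => [|k IH]; first exact: anal_cst.
by apply: anal_ext (analM fa IH) => x; rewrite exprS.
Qed.

Lemma anal_sum (I : Type) (s : seq I) (P : pred I) (F : I -> Cspace R n -> R[i]) :
  (forall j, anal (F j)) -> anal (fun x => \sum_(j <- s | P j) F j x).
Proof.
move=> Fa; elim: s => [|j s IH].
  by apply: anal_ext (anal_cst 0) => x; rewrite big_nil.
case: (boolP (P j)) => Pj; last first.
  by apply: anal_ext IH => x; rewrite big_cons (negPf Pj).
by apply: anal_ext (analD (Fa j) IH) => x; rewrite big_cons Pj.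
Qed.

Lemma ps_eval0 a r M : 0 <= r -> nle a r M -> ps_eval a 0 = a (mi0 n).
Proof.
move=> r0 aM; have pd0 : in_pd r (0 : Cspace R n) by move=> i; rewrite mxE nm0.
apply: (ps_evalE r0 aM pd0) => e e0; exists 1%N => N N1.
rewrite /psum (bigD1_seq (mi0 n)) ?bx_uniq ?mem_bx_deg ?mi_deg0 //=.
rewrite mon_mi0 mulr1 big1 ?addr0 ?subrr ?nm0 // => m m0.
suff [i mi] : exists i, m i != 0%N.
  by rewrite /mon (bigD1 i) //= mxE expr0n (negPf mi) mul0r mulr0.
apply/existsP; apply: contraNT m0 => /existsPn h; apply/eqP/ffunP => i.
by have := h i; rewrite negbK ffunE => /eqP.
Qed.

Lemma anal_cont f (e : R) : anal f -> 0 < e -> near0 (fun x => nm (f x - f 0) < e).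
Proof.
move=> /anal_nle/(_ ltr01)[a [r [M [/andP[r0 _] aM fa]]]] e0.
(* The series of [f - f 0], to which [nle_small] applies. *)
pose b := sadd a (sX (- a (mi0 n)) (mi0 n)).
pose M' := M + nm (a (mi0 n)).
have bM : nle b r M'.
  have := nle_add (ltW r0) aM (nle_sX (- a (mi0 n)) (mi0 n) (ltW r0)).
  by rewrite nmN mi_deg0 mulr1.
have M'0 : 0 <= M' := nle_ge0 (ltW r0) bM.
(* Chosen so that [s / r * M' < e]. *)
pose s := Num.min r (e * r / (M' + 1)).
have s0 : 0 < s by rewrite lt_min r0 divr_gt0 ?mulr_gt0 // ltr_wpDl.
have sr : s <= r by rewrite ge_min lexx.
exists s => // x xs; have xr : in_pd r x by move=> i; apply: le_trans (xs i) sr.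
have pd0 : in_pd r (0 : Cspace R n) by move=> i; rewrite mxE nm0 ltW.
have b0 : b [ffun=> 0%N] = 0 by rewrite /b /sadd /sX eqxx subrr.
have := nm_ps_eval (ltW s0) (nle_small b0 (ltW s0) sr r0 bM) xs.
rewrite (ps_eval_add (ltW r0) aM (nle_sX _ _ (ltW r0)) xr) ps_eval_sX mon_mi0 mulr1.
rewrite fa // fa // (ps_eval0 (ltW r0) aM) => /le_lt_trans; apply.
have : s <= e * r / (M' + 1) by rewrite ge_min lexx orbT.
rewrite ler_pdivlMr ?ltr_wpDl // => h.
rewrite mulrAC ltr_pdivrMr //; apply: lt_le_trans h.
by rewrite ltr_pM2l // ltrDl.
Qed.

Lemma anal_neq0 f : anal f -> f 0 != 0 -> near0 (fun x => f x != 0).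
Proof.
move=> fa f0; have f0' : 0 < nm (f 0) by rewrite nm_gt0.
apply: near0_imp (anal_cont fa f0') => x; apply: contraTneq => ->.
by rewrite sub0r nmN ltxx.
Qed.

Lemma anal_bound f : anal f -> exists2 M : R, 0 < M & near0 (fun x => nm (f x) <= M).
Proof.
move=> fa; exists (nm (f 0) + 1); first by rewrite ltr_wpDl.
apply: near0_imp (anal_cont fa ltr01) => x h.
rewrite -[f x](subrK (f 0)); apply: le_trans (nmD _ _) _.
by rewrite addrC lerD2l ltW.
Qed.

End Analytic.

(** * Fixed points in the Banach algebra of power series *)

Section SeriesFixpoint.
Variables (R : realType) (n : nat).
Implicit Types (a b s t : multi_index n -> R[i]) (x : Cspace R n) (r M : R).

Definition szero : multi_index n -> R[i] := fun=> 0.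

Definition ssub a b : multi_index n -> R[i] := fun m => a m - b m.

Lemma nle_conv_ssub a b s t r A D S E : 0 <= r ->
  nle (ssub s t) r D -> nle a r A -> nle t r S -> nle (ssub a b) r E ->
  nle (ssub (conv s a) (conv t b)) r (D * A + S * E).
Proof.
move=> r0 hD hA hS hE.
have -> : ssub (conv s a) (conv t b) =
    sadd (conv (ssub s t) a) (conv t (ssub a b)).
  apply/funext => m; rewrite /ssub /sadd /conv -sumrB -big_split /=.
  by apply: eq_bigr => k _; rewrite mulrBl mulrBr addrA subrK.
by apply: nle_add => //; apply: nle_conv.
Qed.

Lemma nle_sadd_ssub a b c r M : nle (ssub a b) r M -> nle (ssub (sadd c a) (sadd c b)) r M.
Proof.
move=> h N; apply: le_trans (h N); apply: ler_sum => m _.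
by rewrite /ssub /sadd opprD addrACA subrr add0r.
Qed.

Lemma nle_ssub_trans a b c r M M' : 0 <= r ->
  nle (ssub a b) r M -> nle (ssub b c) r M' -> nle (ssub a c) r (M + M').
Proof.
move=> r0 h h'; have := nle_add r0 h h'; congr nle.
by apply/funext => m; rewrite /sadd /ssub addrA subrK.
Qed.

(** Each partial sum of the norm involves finitely many coefficients, so a norm bound survives
    coefficientwise limits. *)
Lemma nle_lim (u : nat -> multi_index n -> R[i]) (l : multi_index n -> R[i]) r M K :
  0 <= r -> (forall m, clim (fun k => u k m) (l m)) ->
  (forall k, (K <= k)%N -> nle (u k) r M) -> nle l r M.
Proof.
move=> r0 ul uM N; apply/ler_addgt0Pr => e e0.
have [K' HK] : exists K', forall k, (K' <= k)%N ->
    \sum_(m <- bx n N) nm (u k m - l m) * r ^+ mi_deg m < e.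
  elim: (bx n N) e e0 => [|m q IH] e e0.
    by exists 0%N => k _; rewrite big_nil.
  have e2 : 0 < e / 2 by rewrite divr_gt0.
  have c0 : 0 < r ^+ mi_deg m + 1 by rewrite ltr_wpDl // exprn_ge0.
  have [K1 H1] := IH _ e2; have [K2 H2] := ul m _ (divr_gt0 e2 c0).
  exists (maxn K1 K2) => k; rewrite geq_max => /andP[/H1 h1 /H2 h2].
  rewrite big_cons (splitr e) ltr_leD // ?(ltW h1) //.
  move: h2; rewrite ltr_pdivlMr //; apply: le_lt_trans.
  by apply: ler_wpM2l => //; rewrite lerDl.
have hk := HK (maxn K K') (leq_maxr _ _); have hu := uM (maxn K K') (leq_maxl _ _) N.
apply: (le_trans _ (lerD hu (ltW hk))).
rewrite -big_split /=; apply: ler_sum => m _; rewrite -mulrDl ler_wpM2r ?exprn_ge0 //.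
by rewrite -[l m in leLHS](subKr (u (maxn K K') m)); apply: nmB.
Qed.

(** A polynomial in [s] with power series as coefficients, constant term first. In Horner form each
    estimate is one induction on [p]. *)
Definition shorner (p : seq (multi_index n -> R[i])) s :=
  foldr (fun c acc => sadd c (conv s acc)) szero p.

Definition ehorner (p : seq (multi_index n -> R[i])) x (z : R[i]) : R[i] :=
  foldr (fun c acc => ps_eval c x + z * acc) 0 p.

Lemma nle0 r M : 0 <= M -> nle szero r M.
Proof.
by move=> M0 N; rewrite /asum big1 // => m _; rewrite nm0 mul0r.
Qed.

Definition allnle (p : seq (multi_index n -> R[i])) r M :=
  foldr (fun c acc => nle c r M /\ acc) True p.

(** A geometric series of ratio at most 1/2, whence a bound that does not depend on the degree. *)
Lemma nle_shorner p s r M D : 0 <= r -> 0 <= M -> D <= 1/2 -> allnle p r M ->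
  nle s r D -> nle (shorner p s) r (2 * M).
Proof.
move=> r0 M0 D2 hp hs; have D0 := nle_ge0 r0 hs.
elim: p hp => [|c p IH] /=; first by move=> _; apply: nle0; rewrite mulr_ge0.
move=> [cM /IH h]; apply: nle_mono (nle_add r0 cM (nle_conv r0 hs h)).
have : D * (2 * M) <= 1/2 * (2 * M) by apply: ler_wpM2r => //; rewrite mulr_ge0.
lra.
Qed.

(** One Horner step turns a Lipschitz constant [L] into at most [2 M + L / 2], and [4 M] is stable
    under this. *)
Lemma nle_shorner_ssub p s t r M D E : 0 <= r -> 0 <= M -> D <= 1/2 -> allnle p r M ->
  nle s r D -> nle t r D -> nle (ssub s t) r E ->
  nle (ssub (shorner p s) (shorner p t)) r (4 * M * E).
Proof.
move=> r0 M0 D2 hp hs ht hst; have D0 := nle_ge0 r0 hs; have E0 := nle_ge0 r0 hst.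
have ME : 0 <= M * E by rewrite mulr_ge0.
elim: p hp => [|c p IH] /=.
  move=> _; have -> : ssub szero szero = szero.
    by apply/funext => m; rewrite /ssub subrr.
  by apply: nle0; rewrite !mulr_ge0.
move=> [cM hp]; apply: nle_sadd_ssub.
apply: nle_mono (nle_conv_ssub r0 hst (nle_shorner r0 M0 D2 hp hs) ht (IH hp)).
have : D * (4 * M * E) <= 1/2 * (4 * M * E).
  by apply: ler_wpM2r => //; rewrite !mulr_ge0.
lra.
Qed.

Lemma ps_eval_zero x : ps_eval szero x = 0.
Proof.
have -> : szero = sX (0 : R[i]) (mi0 n).
  by apply/funext => m; rewrite /sX; case: ifP.
by rewrite ps_eval_sX mul0r.
Qed.

Lemma ps_eval_shorner p s x r M D : 0 <= r -> 0 <= M -> D <= 1/2 -> allnle p r M ->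
  nle s r D -> in_pd r x -> ps_eval (shorner p s) x = ehorner p x (ps_eval s x).
Proof.
move=> r0 M0 D2 hp hs xr; elim: p hp => [|c p IH] /=; first by rewrite ps_eval_zero.
move=> [cM hp]; have hh := nle_shorner r0 M0 D2 hp hs.
rewrite (ps_eval_add r0 cM (nle_conv r0 hs hh) xr).
by rewrite (ps_eval_conv r0 hs hh xr) IH.
Qed.

Lemma clim_ehorner p x u l : clim u l -> clim (fun k => ehorner p x (u k)) (ehorner p x l).
Proof.
move=> ul; elim: p => [|c p IH] /=; first exact: clim_const.
by apply: climD; [exact: clim_const|exact: climM].
Qed.

Lemma clim_shift u (l : R[i]) : clim u l -> clim (fun k => u k.+1) l.
Proof. by move=> ul e /ul[N HN]; exists N => k Nk; apply: HN; apply: leqW. Qed.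

(* Iteration from 0: the map [s |-> p0 + s (p1 + s (p2 + ...))] is a contraction of a
   small ball for the norm [sum_m |s_m| r^|m|]. *)
Lemma series_fixpoint p0 p1 p r M e D : 0 < r -> 0 <= M ->
  0 < D -> D <= 1/2 -> 16 * M * D <= 1 -> e <= D / 4 ->
  nle p0 r e -> nle p1 r e -> allnle p r M ->
  exists2 s, nle s r D & forall x, in_pd r x ->
    ps_eval s x = ehorner [:: p0, p1 & p] x (ps_eval s x).
Proof.
move=> r0 M0 D0 D2 MD eD h0 h1 hp; have r0' := ltW r0.
pose T s := shorner [:: p0, p1 & p] s.
have e0 : 0 <= e := nle_ge0 r0' h0.
(* The norm is at most [e + D (e + 2 M D)], and [2 M D <= 1/8]. *)
have TD s : nle s r D -> nle (T s) r D.
  move=> hs; have ha := nle_shorner r0' M0 D2 hp hs.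
  apply: nle_mono (nle_add r0' h0 (nle_conv r0' hs (nle_add r0' h1 (nle_conv r0' hs ha)))).
  have h2 : D * (e + D * (2 * M)) <= D * (1/4 + 1/8) by apply: ler_wpM2l; lra.
  lra.
(* The linear coefficient contributes only [e <= 1/8], and each remaining contribution carries a
   factor [M D <= 1/16]; together they give at most 1/2. *)
have TL s t E : nle s r D -> nle t r D -> nle (ssub s t) r E ->
    nle (ssub (T s) (T t)) r (E / 2).
  move=> hs ht hst; apply: nle_sadd_ssub.
  have ha := nle_shorner r0' M0 D2 hp hs.
  have hb := nle_add r0' h1 (nle_conv r0' hs ha).
  have hl := nle_shorner_ssub r0' M0 D2 hp hs ht hst.
  have E0 := nle_ge0 r0' hst.
  have hd := nle_sadd_ssub p1 (nle_conv_ssub r0' hst ha ht hl).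
  apply: nle_mono (nle_conv_ssub r0' hst hb ht hd).
  have q1 : E * (e + D * (2 * M)) <= E * (1/4) by apply: ler_wpM2l; lra.
  have q2 : E * (16 * M * D) <= E * 1 by apply: ler_wpM2l.
  have q3 : D * (D * (4 * M * E)) <= 1/2 * (D * (4 * M * E)).
    by apply: ler_wpM2r => //; rewrite !mulr_ge0 // ltW.
  lra.
pose u k := iter k T szero.
have uD k : nle (u k) r D by elim: k => [|k IH] /=; [exact/nle0/ltW|exact: TD].
have uS k : nle (ssub (u k.+1) (u k)) r (D / 2 ^+ k).
  elim: k => [|k IH].
    rewrite expr0 divr1; have := uD 1%N; congr nle.
    by apply/funext => m; rewrite /ssub subr0.
  have := TL _ _ _ (uD k.+1) (uD k) IH.
  by rewrite exprS invfM [2^-1 * _]mulrC mulrA.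
have uC j k : (j <= k)%N -> nle (ssub (u k) (u j)) r (2 * D / 2 ^+ j - 2 * D / 2 ^+ k).
  move=> /subnK <-; elim: (k - j)%N => [|i IH].
    rewrite add0n subrr; have -> : ssub (u j) (u j) = szero.
      by apply/funext => m; rewrite /ssub subrr.
    exact: nle0.
  rewrite addSn; apply: nle_mono (nle_ssub_trans r0' (uS (i + j)%N) IH).
  rewrite [(2 ^+ (i + j).+1)]exprS invfM.
  set w := 2 ^- j; lra.
have uC2 j k : (j <= k)%N -> nle (ssub (u k) (u j)) r (2 * D / 2 ^+ j).
  move=> /uC; apply: nle_mono; rewrite gerBl divr_ge0 // ?exprn_ge0 //.
  by rewrite mulr_ge0 // ltW.
have D2' : 0 <= 2 * D by rewrite mulr_ge0 // ltW.
(* The limit is built coefficient by coefficient; [nle_lim] then restores the norm bounds. *)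
have coefc m : exists l, clim (fun k => u k m) l.
  apply: complete_C => c c0.
  have [N HN] := small_geo D2' (mulr_gt0 c0 (exprn_gt0 (mi_deg m) r0)).
  exists N => j k Nj jk.
  rewrite -(ltr_pM2r (exprn_gt0 (mi_deg m) r0)).
  by apply: le_lt_trans (HN _ Nj); apply: nle_coef (uC2 _ _ jk).
pose s m := proj1_sig (cid (coefc m)).
have us m : clim (fun k => u k m) (s m) by rewrite /s; case: cid.
have sD : nle s r D by apply: (@nle_lim u s r D 0) => // k _.
have su j : nle (ssub s (u j)) r (2 * D / 2 ^+ j).
  apply: (@nle_lim (fun k => ssub (u k) (u j)) _ r _ j) => //.
    by move=> m; apply: climD => //; exact: clim_const.
  by move=> k; exact: uC2.
exists s => // x xr.
have ev : clim (fun k => ps_eval (u k) x) (ps_eval s x).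
  apply: (clim_sqz (v := fun k => 2 * D / 2 ^+ k)) => [k|]; last by move=> c; exact: small_geo.
  have ss : ssub s (u k) = sadd s (sscale (-1) (u k)).
    by apply/funext => m; rewrite /ssub /sadd /sscale mulN1r.
  have := nm_ps_eval r0' (su k) xr; rewrite ss.
  rewrite (ps_eval_add r0' sD (nle_scale _ (uD k)) xr).
  by rewrite (ps_eval_scale _ r0' (uD k) xr) mulN1r nm_distC.
have mx : allnle [:: p0, p1 & p] r (Num.max M e).
  split; first by apply: nle_mono h0; rewrite le_max lexx orbT.
  split; first by apply: nle_mono h1; rewrite le_max lexx orbT.
  elim: p hp {T TD TL u uD uS uC uC2 coefc s us sD su ev} => [|c p IH] //= [hc /IH hp].
  by split=> //; apply: nle_mono hc; rewrite le_max lexx.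
apply: (clim_uniq (clim_shift ev)).
apply: clim_ext (clim_ehorner [:: p0, p1 & p] x ev) => k.
rewrite -[u k.+1]/(T (u k)) (ps_eval_shorner r0' _ D2 mx (uD k) xr) //.
by rewrite le_max M0.
Qed.

End SeriesFixpoint.

(** * Hensel's lemma for convergent power series *)

Section Hensel.
Variables (R : realType) (n : nat).
Implicit Types (f : Cspace R n -> R[i]) (q : nat -> Cspace R n -> R[i]).

Lemma anal_family q d : (forall k, anal (q k)) ->
  exists (a : nat -> multi_index n -> R[i]) (r M : R),
  [/\ 0 < r, 0 <= M & forall k, (k < d)%N ->
     nle (a k) r M /\ forall x, in_pd r x -> q k x = ps_eval (a k) x].
Proof.
move=> qa; elim: d => [|d [a [r [M [r0 M0 h]]]]].
  by exists (fun=> @szero R n), 1, 0.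
have [b [s [M' [/andP[s0 sr] bM qb]]]] := anal_nle (qa d) r0.
exists (fun k => if k == d then b else a k), s, (Num.max M M').
split=> //; first by rewrite le_max M0.
move=> k; rewrite ltnS leq_eqVlt; case: eqVneq => [-> _|_ /= /h[aM qk]].
  by split=> //; apply: nle_mono bM; rewrite le_max lexx orbT.
split; first by apply: nle_mono (nle_shrink (ltW s0) sr aM); rewrite le_max lexx.
by move=> x xs; apply: qk => i; apply: le_trans (xs i) sr.
Qed.

Lemma ehorner_sum (a : nat -> multi_index n -> R[i]) x z m d :
  ehorner [seq a k | k <- iota m d] x z = \sum_(k < d) ps_eval (a (m + k)%N) x * z ^+ k.
Proof.
elim: d m => [|d IH] m /=; first by rewrite big_ord0.
rewrite big_ord_recl /= addn0 expr0 mulr1 IH mulr_sumr; congr (_ + _).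
by apply: eq_bigr => k _; rewrite mulrCA -exprS addSnnS.
Qed.

Lemma allnle_map (a : nat -> multi_index n -> R[i]) (r M : R) m d :
  (forall k, (m <= k < m + d)%N -> nle (a k) r M) -> allnle [seq a k | k <- iota m d] r M.
Proof.
elim: d m => [|d IH] m h //=; split; first by apply: h; lia.
by apply: IH => k hk; apply: h; lia.
Qed.

(** Shrinking the radius makes [q 0] and [q 1] small in norm, as they vanish at 0, while the other
    coefficients merely stay bounded. *)
Lemma anal_fixpoint q d : (forall k, anal (q k)) -> q 0%N 0 = 0 -> q 1%N 0 = 0 ->
  exists s, [/\ anal s, s 0 = 0 &
    near0 (fun x => s x = \sum_(k < d.+2) q k x * s x ^+ k)].
Proof.
move=> qa q00 q10.
have [a [r [M [r0 M0 h]]]] := anal_family d.+2 qa.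
have pd0 (e : R) : 0 < e -> in_pd e (0 : Cspace R n) by move=> e0 i; rewrite mxE nm0 ltW.
have a0 k : (k < d.+2)%N -> a k (mi0 n) = q k 0.
  by move=> /h[aM ->]; [rewrite (ps_eval0 (ltW r0) aM)|exact: pd0].
(* [D] and the radius [s] below are read off from the hypotheses of [series_fixpoint]. *)
pose D : R := Num.min (1/2) ((16 * (M + 1))^-1).
have M1 : 0 < 16 * (M + 1) by lra.
have D0 : 0 < D by rewrite lt_min invr_gt0 M1 andbT; lra.
have D2 : D <= 1/2 by rewrite ge_min lexx.
have MD : 16 * M * D <= 1.
  have : D <= (16 * (M + 1))^-1 by rewrite ge_min lexx orbT.
  by move=> /(ler_wpM2r (ltW M1)); rewrite mulVf ?gt_eqF //; lra.
pose s := Num.min r (D / 4 * r / (M + 1)).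
have s0 : 0 < s by rewrite lt_min r0 divr_gt0 ?mulr_gt0 //; lra.
have sr : s <= r by rewrite ge_min lexx.
have small k : (k < d.+2)%N -> a k (mi0 n) = 0 -> nle (a k) s (D / 4).
  move=> kd ak0; apply: nle_mono (nle_small ak0 (ltW s0) sr r0 (h _ kd).1).
  have : s <= D / 4 * r / (M + 1) by rewrite ge_min lexx orbT.
  rewrite ler_pdivlMr; last by lra.
  by move=> hs; rewrite [s / r * M]mulrAC ler_pdivrMr //; lra.
have alls : allnle [seq a k | k <- iota 2 d] s M.
  apply: allnle_map => k hk; apply: nle_shrink (ltW s0) sr _.
  by apply: (h _ _).1; lia.
have h0 := small 0%N isT; have h1 := small 1%N isT.
rewrite !a0 // in h0 h1.
have [w wD we] := series_fixpoint s0 M0 D0 D2 MD (lexx _) (h0 q00) (h1 q10) alls.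
have weq x : in_pd s x ->
    ps_eval w x = \sum_(k < d.+2) q k x * ps_eval w x ^+ k.
  move=> xs; rewrite {1}(we x xs) -[[:: _, _ & _]]/[seq a k | k <- iota 0 d.+2].
  rewrite ehorner_sum; apply: eq_bigr => k _; rewrite add0n.
  rewrite (h k (ltn_ord k)).2 // => i; exact: le_trans (xs i) sr.
exists (ps_eval w); split.
- exact: (nle_anal s0 wD).
(* At 0 the equation reads [w = w^2 acc] with [|w| <= D] and [|acc| <= 2 M], so [|w| <= |w| / 8]. *)
- have x0 := pd0 s s0; have := we _ x0; rewrite /=.
  rewrite -(ps_eval_shorner (ltW s0) M0 D2 alls wD x0).
  have := nm_ps_eval (ltW s0) (nle_shorner (ltW s0) M0 D2 alls wD) x0.
  set acc := ps_eval (shorner _ _) _ => hacc.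
  have -> : ps_eval (a 0%N) 0 = 0 by rewrite -(h 0%N isT).2 //; exact: pd0.
  have -> : ps_eval (a 1%N) 0 = 0 by rewrite -(h 1%N isT).2 //; exact: pd0.
  rewrite !add0r => e; have := nm_ps_eval (ltW s0) wD x0 => hw.
  apply/eqP; rewrite -nm_eq0 eq_le nm_ge0 andbT.
  have : nm (ps_eval w 0) <= nm (ps_eval w 0) * (D * (2 * M)).
    rewrite {1}e !nmM; apply: ler_wpM2l => //; apply: ler_pM => //.
  have : nm (ps_eval w 0) * (D * (2 * M)) <= nm (ps_eval w 0) * (1/8).
    by apply: ler_wpM2l => //; lra.
  by have := nm_ge0 (ps_eval w 0); lra.
- by exists s.
Qed.

(** A Newton step as a fixed point equation: with [P] the polynomial and [c] its derivative at the
    simple root [t0], solve [z = z - P(t0 + z) / c]. Its constant and linear coefficients vanish at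
    0. *)
Lemma anal_root q d (t0 : R[i]) : (forall k, anal (q k)) ->
  \sum_(k < d) q k 0 * t0 ^+ k = 0 ->
  \sum_(k < d) (q k 0 * t0 ^+ k.-1) *+ k != 0 ->
  exists t, [/\ anal t, t 0 = t0 & near0 (fun x => \sum_(k < d) q k x * t x ^+ k = 0)].
Proof.
case: d => [|[|d]] qa; first by rewrite !big_ord0 eqxx.
  by move=> _; rewrite big_ord1 mulr0n eqxx.
move=> z0 z1; set c := \sum_(k < _) _ in z1.
(* Taylor coefficients at [t0]. For [k < j] the subtraction truncates, but the binomial is 0. *)
pose Q j x := \sum_(k < d.+2) q k x * t0 ^+ (k - j) *+ 'C(k, j).
have QE x z : \sum_(k < d.+2) q k x * (t0 + z) ^+ k = \sum_(j < d.+2) Q j x * z ^+ j.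
  under [RHS]eq_bigr => j _ do rewrite mulr_suml.
  rewrite exchange_big /=; apply: eq_bigr => k _; rewrite exprDn mulr_sumr.
  rewrite (big_ord_widen d.+2 (fun i : nat => q k x * (t0 ^+ (k - i) * z ^+ i *+ 'C(k, i)))) //.
  rewrite big_mkcond; apply: eq_bigr => j _; case: ifP => [_|].
    by rewrite mulrnAr mulrA mulrnAl.
  by rewrite ltnS => /negbT; rewrite -ltnNge => kj; rewrite bin_small // mulr0n mul0r.
have Qa j : anal (Q j).
  apply: anal_sum => k.
  apply: anal_ext (analM (qa k) (anal_cst n (t0 ^+ (k - j) *+ 'C(k, j)))) => x.
  by rewrite mulrnAr.
have Q0 : Q 0%N 0 = 0 by rewrite -z0; apply: eq_bigr => k _; rewrite bin0 subn0.
have Q1 : Q 1%N 0 = c by apply: eq_bigr => k _; rewrite bin1 subn1.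
pose p j x := (j == 1%N)%:R - Q j x / c.
have pa j : anal (p j) by apply: analB; [exact: anal_cst|apply: analM => //; exact: anal_cst].
have [||s [sa s0 se]] := @anal_fixpoint p d pa.
- by rewrite /p Q0 mul0r subr0.
- by rewrite /p Q1 divff // subrr.
exists (fun x => t0 + s x); split; first by apply: analD => //; exact: anal_cst.
  by rewrite s0 addr0.
apply: near0_imp se => x; rewrite QE => se.
have : \sum_(k < d.+2) p k x * s x ^+ k = s x - (\sum_(j < d.+2) Q j x * s x ^+ j) / c.
  under eq_bigr do rewrite /p mulrBl; rewrite sumrB mulr_suml; congr (_ - _).
    rewrite (bigD1 (Ordinal (isT : (1 < d.+2)%N))) //= mul1r expr1 big1 ?addr0 //.
    by move=> j j1; rewrite (_ : (j == 1%N :> nat) = false) ?mul0r //; apply/negbTE.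
  by apply: eq_bigr => j _; rewrite mulrAC.
rewrite -se => /eqP; rewrite -subr_eq0 opprB addrC subrK mulf_eq0 invr_eq0 (negPf z1) orbF.
by move/eqP.
Qed.

Lemma anal_nthroot f k (t0 : R[i]) : anal f -> (0 < k)%N -> t0 ^+ k = f 0 -> f 0 != 0 ->
  exists t, [/\ anal t, t 0 = t0 & near0 (fun x => t x ^+ k = f x)].
Proof.
move=> fa k0 t0k f0.
(* The coefficients of [T^k - f]. *)
pose q j x := (j == k)%:R - (j == 0%N)%:R * f x.
have q_sum (F : nat -> R[i]) x : \sum_(j < k.+1) q j x * F j = F k - f x * F 0%N.
  rewrite (bigD1 ord_max) //= (bigD1 ord0) /=; last first.
    by rewrite -val_eqE /= neq_ltn k0.
  rewrite /q eqxx eqxx eqn0Ngt k0 [0%N == k]eq_sym eqn0Ngt k0 /= mul0r subr0 mul1r.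
  rewrite big1 ?addr0 => [|j /andP[jk j0]]; first by rewrite sub0r mul1r mulNr.
  have /negPf -> : (j != k :> nat) by apply: contra jk => /eqP jk; apply/eqP/val_inj.
  have /negPf -> : (j != 0%N :> nat) by apply: contra j0 => /eqP j0; apply/eqP/val_inj.
  by rewrite mul0r subrr mul0r.
have qa j : anal (q j).
  by apply: analB; [exact: anal_cst|apply: analM => //; exact: anal_cst].
have [||t [ta tt0 te]] := @anal_root q k.+1 t0 qa.
- by rewrite (q_sum (fun j => t0 ^+ j)) t0k expr0 mulr1 subrr.
- under eq_bigr do rewrite -mulrnAr.
  rewrite (q_sum (fun j => t0 ^+ j.-1 *+ j)) mulr0n mulr0 subr0.
  rewrite mulrn_eq0 negb_or -lt0n k0 expf_eq0 negb_and.
  suff -> : t0 != 0 by rewrite orbT.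
  by apply: contraNneq f0 => t00; rewrite -t0k t00 expr0n gtn_eqF.
exists t; split=> //; apply: near0_imp te => x.
by rewrite (q_sum (fun j => t x ^+ j)) expr0 mulr1 => /eqP; rewrite subr_eq0 => /eqP.
Qed.

End Hensel.

(** * Division by the coordinates and Lipschitz bounds *)

Section Hadamard.
Variables (R : realType) (n : nat).
Implicit Types (a : multi_index n -> R[i]) (f : Cspace R n -> R[i]) (r M : R).

(** Each nonconstant monomial is divided by a single variable, the one that [pick] selects among
    those occurring in it, so that [f - f(0) = sum_i x_i g_i] counts it once. *)
Definition shift_coef a (i : 'I_n) : multi_index n -> R[i] := fun m =>
  if [pick j | madd (mi1 i) m j != 0%N] == Some i then a (madd (mi1 i) m) else 0.

Lemma mi_deg1 (i : 'I_n) : mi_deg (mi1 i) = 1%N.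
Proof.
rewrite /mi_deg (bigD1 i) //= ffunE eqxx big1 // => j ji.
by rewrite ffunE (negPf ji).
Qed.

Lemma nle_shift_coef a i r M : 0 < r -> nle a r M -> nle (shift_coef a i) r (M / r).
Proof.
move=> r0 aM N; rewrite ler_pdivlMr // mulrC.
apply: le_trans (aM N.+1); rewrite /asum mulr_sumr.
pose F m := nm (a m) * r ^+ mi_deg m.
have F0 m : 0 <= F m by rewrite mulr_ge0 // exprn_ge0 // ltW.
apply: (@le_trans _ _ (\sum_(m <- [seq madd (mi1 i) m | m <- bx n N]) F m)).
  rewrite [leRHS]big_map; apply: ler_sum => m _.
  rewrite mulrCA -exprS /F mi_deg_add mi_deg1 add1n /shift_coef.
  by case: ifP => _ //; rewrite nm0 mul0r mulr_ge0 // exprn_ge0 // ltW.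
apply: ler_sum_sub => //; rewrite ?bx_uniq //.
  rewrite map_inj_uniq ?bx_uniq // => l l' e.
  by rewrite -(msubK (mi1 i) l) e msubK.
move=> m /mapP[l]; rewrite !mem_bx => /forallP lN ->; apply/forallP => j.
by rewrite !ffunE; have := lN j; case: (j == i) => /=; lia.
Qed.

Lemma conv_mi1 a i m :
  conv (sX 1 (mi1 i)) a m = if mle (mi1 i) m then a (msub m (mi1 i)) else 0.
Proof.
rewrite /conv; case: ifP => him; last first.
  rewrite big1 // => k km; rewrite /sX; case: eqP => [e|_]; last by rewrite mul0r.
  by rewrite e him in km.
rewrite big_mkcond (bigD1_seq (mi1 i)) ?bx_uniq //=; last first.
  by apply: (mle_bx him); rewrite mem_bx_deg.
rewrite him /sX eqxx mul1r big1 ?addr0 // => k /negPf ->.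
by rewrite mul0r if_same.
Qed.

Lemma coef_hadamard a m : a m = (if m == mi0 n then a (mi0 n) else 0) +
  \sum_i conv (sX 1 (mi1 i)) (shift_coef a i) m.
Proof.
have [->|m0] := eqVneq m (mi0 n).
  rewrite big1 ?addr0 // => i _; rewrite conv_mi1; case: ifP => // /forallP/(_ i).
  by rewrite !ffunE eqxx.
rewrite add0r.
have cE i : conv (sX 1 (mi1 i)) (shift_coef a i) m =
    if [pick j | m j != 0%N] == Some i then a m else 0.
  rewrite conv_mi1; case: ifP => him; first by rewrite /shift_coef maddK.
  case: pickP => //= j mj; case: eqP => // -[ji]; move/negP: him; case.
  apply/forallP => k; rewrite ffunE; case: eqP => //= ->.
  by rewrite -ji lt0n.
under eq_bigr do rewrite cE; case: pickP => [j mj|h].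
  rewrite (bigD1 j) //= eqxx big1 ?addr0 // => i ij.
  by case: eqP => // -[ji]; rewrite ji eqxx in ij.
by case/eqP: m0; apply/ffunP => i; have /negbT := h i; rewrite negbK ffunE => /eqP.
Qed.

Lemma ps_eval_sum (I : Type) (l : seq I) (s : I -> multi_index n -> R[i]) x r M :
  0 <= r -> 0 <= M -> (forall i, nle (s i) r M) -> in_pd r x ->
  ps_eval (fun m => \sum_(i <- l) s i m) x = \sum_(i <- l) ps_eval (s i) x.
Proof.
move=> r0 M0 sM xr.
suff [] : nle (fun m => \sum_(i <- l) s i m) r (M *+ size l) /\
   ps_eval (fun m => \sum_(i <- l) s i m) x = \sum_(i <- l) ps_eval (s i) x by [].
elim: l => [|i l [IHM IH]].
  have -> : (fun m => \sum_(i <- [::]) s i m) = @szero R n.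
    by apply/funext => m; rewrite big_nil.
  by rewrite ps_eval_zero big_nil; split=> //; apply: nle0.
have -> : (fun m => \sum_(i <- i :: l) s i m) =
    sadd (s i) (fun m => \sum_(i <- l) s i m).
  by apply/funext => m; rewrite big_cons.
rewrite big_cons -IH (ps_eval_add r0 (sM i) IHM xr) /= mulrS; split=> //.
exact: nle_add.
Qed.

Lemma anal_hadamard f : anal f -> exists g : 'I_n -> Cspace R n -> R[i],
  (forall i, anal (g i)) /\ near0 (fun x => f x = f 0 + \sum_i (x 0 i : R[i]) * g i x).
Proof.
move=> /anal_nle/(_ ltr01)[a [r [M [/andP[r0 _] aM fa]]]]; have r0' := ltW r0.
have gM i := nle_shift_coef i r0 aM.
exists (fun i => ps_eval (shift_coef a i)); split.
  by move=> i; apply: (nle_anal r0 (gM i)).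
exists r => // x xr.
have pd0 : in_pd r (0 : Cspace R n) by move=> i; rewrite mxE nm0.
rewrite fa // fa // (ps_eval0 r0' aM).
have aE : a = sadd (sX (a (mi0 n)) (mi0 n))
    (fun m => \sum_i conv (sX 1 (mi1 i)) (shift_coef a i) m).
  by apply/funext => m; rewrite {1}coef_hadamard.
have cM i : nle (conv (sX 1 (mi1 i)) (shift_coef a i)) r (r * (M / r)).
  apply: nle_conv => //; have := nle_sX 1 (mi1 i) r0'.
  by rewrite nm1 mul1r mi_deg1 expr1.
have M0 : 0 <= r * (M / r) by rewrite mulr_ge0 // divr_ge0 // (nle_ge0 r0' aM).
have sM : exists M', nle (fun m => \sum_i conv (sX 1 (mi1 i)) (shift_coef a i) m) r M'.
  exists (M + nm (a (mi0 n))).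
  have := nle_add r0' aM (nle_sX (- a (mi0 n)) (mi0 n) r0').
  rewrite nmN mi_deg0 expr0 mulr1; congr nle; apply/funext => m.
  rewrite /sadd {1}(coef_hadamard a m) /sX; case: eqP => _; last by rewrite addr0 add0r.
  by rewrite addrAC subrr add0r.
case: sM => M' sM.
rewrite {1}aE (ps_eval_add r0' (nle_sX _ _ r0') sM xr) ps_eval_sX mon_mi0 mulr1.
congr (_ + _); rewrite (ps_eval_sum _ r0' M0 cM xr); apply: eq_bigr => i _.
by rewrite (ps_eval_conv r0' (nle_sX _ _ r0') (gM i) xr) ps_eval_sX mon_mi1 mul1r.
Qed.

(** The mean value bound [|m| r^(|m|-1) d], multiplied by [r] so that degree 0 is no exception. In
    this form it is multiplicative in the monomial. *)
Lemma mon_lip (x y : Cspace R n) (r d : R) m : 0 <= r ->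
  in_pd r x -> in_pd r y -> (forall i, nm (x 0 i - y 0 i : R[i]) <= d) ->
  r * nm (mon x m - mon y m) <= (mi_deg m)%:R * r ^+ mi_deg m * d.
Proof.
move=> r0 xr yr xyd.
pose good k (p q : R[i]) := [/\ nm p <= r ^+ k, nm q <= r ^+ k &
  r * nm (p - q) <= k%:R * r ^+ k * d].
have good1 : good 0%N 1 1.
  by split; rewrite ?nm1 // subrr nm0 mulr0 !mul0r.
have goodM k l p q p' q' : good k p q -> good l p' q' -> good (k + l)%N (p * p') (q * q').
  move=> [h1 h2 h3] [g1 g2 g3].
  split; [by rewrite nmM exprD ler_pM|by rewrite nmM exprD ler_pM|rewrite exprD].
  have -> : p * p' - q * q' = (p - q) * p' + q * (p' - q') by ring.
  apply: le_trans (ler_wpM2l r0 (nmD _ _)) _; rewrite !nmM mulrDr.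
  have u1 : r * (nm (p - q) * nm p') <= k%:R * r ^+ k * d * r ^+ l.
    by rewrite mulrA; apply: ler_pM => //; rewrite mulr_ge0.
  have u2 : r * (nm q * nm (p' - q')) <= r ^+ k * (l%:R * r ^+ l * d).
    by rewrite mulrCA; apply: ler_pM => //; rewrite mulr_ge0.
  apply: le_trans (lerD u1 u2) _; rewrite natrD le_eqVlt; apply/orP; left; apply/eqP; ring.
have goodX k i : good k ((x 0 i : R[i]) ^+ k) ((y 0 i : R[i]) ^+ k).
  elim: k => [|k IH]; first by rewrite !expr0.
  rewrite !exprS; apply: (goodM 1%N) => //; split; rewrite ?expr1 ?xr ?yr //.
  by rewrite mul1r; apply: ler_wpM2l.
suff [] : good (mi_deg m) (mon x m) (mon y m) by [].
rewrite /mi_deg /mon; elim: (index_enum _) => [|i l IH]; first by rewrite !big_nil.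
by rewrite !big_cons; apply: goodM.
Qed.

(** At half the radius, [|m| s^|m| <= (2 s)^|m|] absorbs the degree produced by [mon_lip]. *)
Lemma anal_lip f : anal f -> exists r L : R, [/\ 0 < r, 0 < L &
  forall x y d, 0 <= d -> in_pd r x -> in_pd r y ->
    (forall i, nm (x 0 i - y 0 i : R[i]) <= d) -> nm (f x - f y) <= L * d].
Proof.
move=> /anal_nle/(_ ltr01)[a [r [M [/andP[r0 _] aM fa]]]].
have M0 := nle_ge0 (ltW r0) aM.
set s := r / 2; have s0 : 0 < s by rewrite divr_gt0.
have sr : s <= r by rewrite /s; lra.
exists s, ((M + 1) / s); split=> //; first by rewrite divr_gt0 // ltr_wpDl.
move=> x y d d0 xs ys xyd.
have xr : in_pd r x by move=> i; apply: le_trans (xs i) sr.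
have yr : in_pd r y by move=> i; apply: le_trans (ys i) sr.
rewrite fa // fa // mulrAC ler_pdivlMr // mulrC.
have hl : clim (fun N => psum a x N - psum a y N) (ps_eval a x - ps_eval a y).
  have := climD (ps_eval_clim (ltW r0) aM xr)
    (climM (clim_const (-1)) (ps_eval_clim (ltW r0) aM yr)).
  by rewrite mulN1r; apply: clim_ext => N; rewrite mulN1r.
rewrite mulrC -ler_pdivlMr //; apply: (clim_nm_le (N := 0) hl) => N _.
rewrite ler_pdivlMr // mulrC /psum -sumrB.
apply: le_trans (ler_wpM2l (ltW s0) (nm_sum _ _ _)) _; rewrite mulr_sumr.
apply: (@le_trans _ _ (M * d)); last by apply: ler_wpM2r => //; rewrite lerDl.
apply: le_trans (ler_wpM2r d0 (aM N)); rewrite /asum mulr_suml.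
apply: ler_sum => m _; rewrite -mulrBr nmM mulrCA -[leRHS]mulrA. apply: ler_wpM2l => //.
apply: le_trans (mon_lip m (ltW s0) xs ys xyd) _; apply: ler_wpM2r => //.
have -> : r = 2 * s by rewrite /s mulrC divfK.
rewrite [leRHS]exprMn; apply: ler_wpM2r; first by rewrite exprn_ge0 // ltW.
by rewrite -natrX ler_nat ltnW // ltn_expl.
Qed.

End Hadamard.

(** * Fixed points in C^n *)

Section FixedPoint.
Variable R : realType.

Lemma geo_cauchy (u : nat -> R[i]) (c : R) : 0 <= c ->
  (forall k, nm (u k.+1 - u k) <= c / 2 ^+ k) ->
  exists2 l, clim u l & forall k, nm (u k - l) <= 2 * c / 2 ^+ k.
Proof.
(* Minus the geometric tail: increments of [T] dominate those of [u], and 0 bounds it. *)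
move=> c0 uc; pose T k : R := - (2 * c / 2 ^+ k).
have uT j k : (j <= k)%N -> nm (u k - u j) <= T k - T j.
  move=> /subnK <-; elim: (k - j)%N => [|i IH].
    by rewrite add0n !subrr nm0.
  have -> : u (i.+1 + j)%N - u j = (u (i + j).+1 - u (i + j)%N) + (u (i + j)%N - u j).
    by rewrite addrA subrK.
  apply: le_trans (nmD _ _) _; apply: le_trans (lerD (uc _) IH) _.
  rewrite /T addSn [(2 ^+ (i + j).+1)]exprS invfM; set w := 2 ^- j; lra.
have T0 k : T k <= 0 by rewrite oppr_le0 divr_ge0 // ?mulr_ge0 // exprn_ge0.
have [l ul] := complete_mono uT T0.
exists l => // k; rewrite nm_distC.
have ul' : clim (fun j => u j - u k) (l - u k) by apply: climD => //; exact: clim_const.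
apply: (clim_nm_le (N := k) ul') => j kj; apply: le_trans (uT _ _ kj) _.
by have := T0 j; rewrite /T; lra.
Qed.

Variable n : nat.

(** Banach's iteration from 0 in the maximum norm, with limits taken coordinatewise. *)
Lemma vec_fixpoint (T : Cspace R n -> Cspace R n) (r : R) : 0 < r ->
  (forall x, in_pd (2 * r) x -> in_pd r (T x)) ->
  (forall x y d, 0 <= d -> in_pd (2 * r) x -> in_pd (2 * r) y ->
    (forall i, nm (x 0 i - y 0 i : R[i]) <= d) ->
    forall i, nm (T x 0 i - T y 0 i : R[i]) <= d / 2) ->
  exists2 x, in_pd (2 * r) x & T x = x.
Proof.
move=> r0 Tr TL; pose u k := iter k T 0.
have r2 : r <= 2 * r by lra.
have uD k : in_pd (2 * r) (u k).
  case: k => [|k] i; first by rewrite mxE nm0; lra.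
  suff: in_pd (2 * r) (u k) by move=> /Tr /(_ i) h; apply: le_trans h r2.
  elim: k => [|k IH] j; first by rewrite mxE nm0; lra.
  by apply: le_trans (Tr _ IH j) r2.
have uS k i : nm (u k.+1 0 i - u k 0 i : R[i]) <= r / 2 ^+ k.
  elim: k i => [|k IH] i.
    rewrite expr0 divr1 [u 0%N 0 i]mxE subr0; apply: Tr.
    by move=> j; rewrite mxE nm0; lra.
  rewrite exprS invfM [2^-1 * _]mulrC mulrA.
  apply: (TL (u k.+1) (u k) _ _ (uD k.+1) (uD k) (IH)).
  by rewrite divr_ge0 ?exprn_ge0 // ltW.
pose l i := s2val (cid2 (geo_cauchy (ltW r0) (fun k => uS k i))).
have ul i : clim (fun k => u k 0 i : R[i]) (l i) by rewrite /l; case: cid2.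
have uk i k : nm (u k 0 i - l i : R[i]) <= 2 * r / 2 ^+ k by rewrite /l; case: cid2.
pose x : Cspace R n := \row_i (l i : R[i]^o).
have xr : in_pd (2 * r) x.
  by move=> i; rewrite mxE; apply: (clim_nm_le (N := 0) (ul i)) => k _; exact: uD.
exists x => //; apply/rowP => i; rewrite [RHS]mxE.
apply: (clim_uniq (u := fun k => u k.+1 0 i)); last first.
  exact: (clim_shift (ul i)).
apply: (clim_sqz (v := fun k => 2 * r / 2 ^+ k)) => [k|e e0]; last first.
  by apply: small_geo => //; lra.
have d0 : 0 <= 2 * r / 2 ^+ k by rewrite divr_ge0 ?exprn_ge0 //; lra.
apply: (@le_trans _ _ (2 * r / 2 ^+ k / 2)); last by rewrite ler_pdivrMr //; lra.
by apply: (TL (u k) x) => // j; rewrite mxE; exact: uk.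
Qed.

(* For small [s] the right-hand side is a contraction of a small polydisc. *)
Lemma curve_point (G G' : 'I_n -> Cspace R n -> R[i]) (p q : 'I_n -> nat) (e : R) :
  0 < e -> (forall i, anal (G i)) -> (forall i, anal (G' i)) ->
  (forall i, (0 < p i)%N) -> (forall i, (0 < q i)%N) ->
  exists2 s : R[i], s != 0 & exists2 x, in_pd e x &
    forall i, (x 0 i : R[i]) = s ^+ p i * G i x + s ^+ q i * G' i x.
Proof.
move=> e0 Ga G'a p0 q0.
(* One radius and one constant serve as bound and as Lipschitz constant for all components. *)
have key (F : 'I_n -> Cspace R n -> R[i]) : (forall i, anal (F i)) ->
    exists r C : R, [/\ 0 < r, 0 < C & forall i, 
      (forall x, in_pd r x -> nm (F i x) <= C) /\
      (forall x y d, 0 <= d -> in_pd r x -> in_pd r y ->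
       (forall j, nm (x 0 j - y 0 j : R[i]) <= d) -> nm (F i x - F i y) <= C * d)].
  move=> Fa; suff : forall s : seq 'I_n, exists r C : R, [/\ 0 < r, 0 < C & forall i, 
      i \in s -> (forall x, in_pd r x -> nm (F i x) <= C) /\
      (forall x y d, 0 <= d -> in_pd r x -> in_pd r y ->
       (forall j, nm (x 0 j - y 0 j : R[i]) <= d) -> nm (F i x - F i y) <= C * d)].
    move=> /(_ (enum 'I_n))[r [C [r0 C0 h]]]; exists r, C; split=> // i.
    by apply: h; rewrite mem_enum.
  elim=> [|i s [r [C [r0 C0 h]]]]; first by exists 1, 1.
  have [B B0 [b b0 Bb']] := anal_bound (Fa i).
  have Bb x : in_pd b x -> nm (F i x) <= B := Bb' x.
  have [c [L [c0 L0 Lc]]] := anal_lip (Fa i).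
  exists (Num.min r (Num.min b c)), (Num.max C (Num.max B L)); split.
  - by rewrite !lt_min r0 b0.
  - by rewrite lt_max C0.
  move=> j; rewrite inE => js.
  have sub (t : R) (x : Cspace R n) : Num.min r (Num.min b c) <= t ->
    in_pd (Num.min r (Num.min b c)) x -> in_pd t x by move=> ht hx k; apply: le_trans (hx k) ht.
  case/orP: js => [/eqP ->|/h[h1 h2]]; split.
  - move=> x xr; apply: le_trans (Bb x (sub _ _ _ xr)) _.
      by rewrite !ge_min lexx !orbT.
    by rewrite !le_max lexx !orbT.
  - move=> x y d d0 xr yr xyd; apply: le_trans (Lc x y d d0 (sub _ _ _ xr) (sub _ _ _ yr) xyd) _;
      rewrite ?ge_min ?lexx ?orbT //.
    by apply: ler_wpM2r => //; rewrite !le_max lexx !orbT.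
  - move=> x xr; apply: le_trans (h1 x (sub _ _ _ xr)) _; rewrite ?ge_min ?le_max ?lexx //.
  - move=> x y d d0 xr yr xyd; apply: le_trans (h2 x y d d0 (sub _ _ _ xr) (sub _ _ _ yr) xyd) _;
      rewrite ?ge_min ?lexx //.
    by apply: ler_wpM2r => //; rewrite le_max lexx.
have [r1 [C1 [r10 C10 h1]]] := key G Ga.
have [r2 [C2 [r20 C20 h2]]] := key G' G'a.
pose r := Num.min (e / 2) (Num.min (r1 / 2) (r2 / 2)).
have r0 : 0 < r by rewrite !lt_min !divr_gt0.
have re : 2 * r <= e by rewrite mulrC -ler_pdivlMr // ge_min lexx.
have rr1 : 2 * r <= r1 by rewrite mulrC -ler_pdivlMr // !ge_min lexx orbT.
have rr2 : 2 * r <= r2 by rewrite mulrC -ler_pdivlMr // !ge_min lexx !orbT.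
(* [s <= 1] gives [s^p <= s] for positive [p]; the other two bounds make [T] map into the polydisc
   of radius [r] and contract by 1/2. *)
pose s : R := Num.min 1 (Num.min (r / (C1 + C2)) (2^-1 / (C1 + C2))).
have C12 : 0 < C1 + C2 by rewrite addr_gt0.
have s0 : 0 < s by rewrite !lt_min ltr01 !divr_gt0.
have s1 : s <= 1 by rewrite ge_min lexx.
have sr : s * (C1 + C2) <= r by rewrite -ler_pdivlMr // !ge_min lexx orbT.
have s2 : s * (C1 + C2) <= 2^-1 by rewrite -ler_pdivlMr // !ge_min lexx !orbT.
have sX k : (0 < k)%N -> nm (s%:C ^+ k) <= s.
  move=> k0; rewrite nmX nmR ?(ltW s0) // -[k]prednK // exprS ler_piMr ?(ltW s0) //.
  by rewrite exprn_ile1 // ltW.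
have sub (t : R) (x : Cspace R n) : 2 * r <= t -> in_pd (2 * r) x -> in_pd t x.
  by move=> ht hx k; apply: le_trans (hx k) ht.
pose T x : Cspace R n := \row_i (s%:C ^+ p i * G i x + s%:C ^+ q i * G' i x : R[i]^o).
have [||x xr Tx] := @vec_fixpoint T r r0.
- move=> x xr i; rewrite mxE; apply: le_trans (nmD _ _) _; rewrite !nmM.
  apply: le_trans sr; rewrite mulrDr; apply: lerD; apply: ler_pM => //; try exact: sX.
    by apply: (h1 i).1; apply: sub xr.
  by apply: (h2 i).1; apply: sub xr.
- move=> x y d d0 xr yr xyd i; rewrite !mxE.
  have -> : s%:C ^+ p i * G i x + s%:C ^+ q i * G' i x -
     (s%:C ^+ p i * G i y + s%:C ^+ q i * G' i y) =
     s%:C ^+ p i * (G i x - G i y) + s%:C ^+ q i * (G' i x - G' i y) by ring.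
  apply: le_trans (nmD _ _) _; rewrite !nmM.
  apply: (@le_trans _ _ (s * (C1 * d) + s * (C2 * d))).
    apply: lerD; apply: ler_pM => //; try exact: sX.
      by apply: (h1 i).2 => //; apply: sub.
    by apply: (h2 i).2 => //; apply: sub.
  rewrite -mulrDr -mulrDl mulrA mulrC; exact: ler_wpM2l.
exists s%:C; first by rewrite -nm_gt0 nmR // ltW.
exists x; first exact: sub xr.
by move=> i; rewrite -{1}Tx mxE.
Qed.


End FixedPoint.

(** * Smooth sections *)

Section Sections.
Variables (R : realType) (n : nat).
Implicit Types (f g h u v w e : Cspace R n -> R[i]) (A B Z : set (Cspace R n)).

Lemma germ_eqP A B : germ_eq A B <-> near0 (fun x => A x <-> B x).
Proof. exact: near0P. Qed.

Lemma analytic_germ_anal k (f : 'I_k -> Cspace R n -> R[i]) :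
  (forall j, anal (f j)) -> analytic_germ [set x | forall j, f j x = 0].
Proof.
move=> fa; pose a j := s2val (cid2 (fa j)).
have ac j : convergent (a j) by rewrite /a; case: cid2.
have fE j : near0 (fun x => f j x = ps_eval (a j) x) by rewrite /a; case: cid2.
exists k, a; split=> //; apply/germ_eqP.
apply: near0_imp (near0_forall fE) => x fx; split=> [h j _|h j].
  by rewrite /zero_set /= -fx.
by rewrite fx; apply: h.
Qed.

Lemma analytic_germ2 f g : anal f -> anal g -> analytic_germ [set x | f x = 0 /\ g x = 0].
Proof.
move=> fa ga.
have := @analytic_germ_anal 2 (fun j => if j == ord0 then f else g).
have -> : [set x | forall j : 'I_2, (if j == ord0 then f else g) x = 0] =
    [set x | f x = 0 /\ g x = 0].
  apply/seteqP; split=> x /=; last by move=> [fx gx] j; case: ifP.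
  by move=> h; split; [exact: (h ord0)|exact: (h ord_max)].
by apply=> j; case: ifP.
Qed.

(** The inverse is the simple root of [u T - 1]. *)
Lemma anal_inv u : anal u -> u 0 != 0 ->
  exists2 t, anal t & near0 (fun x => u x * t x = 1).
Proof.
move=> ua u0.
have [|||t [ta _ te]] := @anal_root R n (fun k x => if k == 0%N then -1 else u x) 2 (u 0)^-1.
- by case=> [|k] //; exact: anal_cst.
- by rewrite !big_ord_recl big_ord0 /= expr0 expr1 mulr1 addr0 divff // addNr.
- rewrite !big_ord_recl big_ord0 /= mulr0n add0r addr0 expr0 mulr1 mulr1n //.
exists t => //; apply: near0_imp te => x.
rewrite !big_ord_recl big_ord0 /= expr0 expr1 mulr1 addr0 => /eqP.
by rewrite addrC subr_eq0 => /eqP.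
Qed.

(** * Splitting [f = 0] on the surface [h = 0], where [x_i] can be eliminated *)

Section Main.
Variables (f h u v w e : Cspace R n -> R[i]) (i j l : 'I_n) (p r k : nat).
Variables (q : nat -> Cspace R n -> R[i]) (c : R[i]).
Hypotheses (ha : anal h) (ua : anal u) (va : anal v) (wa : anal w) (ea : anal e).
Hypotheses (qa : forall m, anal (q m)).
Hypotheses (ij : i != j) (il : i != l) (jl : j != l).
Hypotheses (p0 : (0 < p)%N) (r0 : (0 < r)%N) (k0 : (0 < k)%N) (k2 : ~~ odd k).
Hypotheses (u0 : u 0 != 0) (e0 : e 0 != 0) (c0 : c != 0).
Hypothesis hE : near0 (fun x => h x =
  (x 0 i : R[i]) * u x + (x 0 j : R[i]) * v x + (x 0 l : R[i]) * w x).
(** With the coefficients frozen at 0 the form is [c (A^k + B^k)], all of whose roots [A / B] are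
    simple. *)
Hypothesis q0 : forall m, (m <= k)%N -> q m 0 = if (m == 0%N) || (m == k) then c else 0.

Let A (x : Cspace R n) : R[i] := (x 0 j : R[i]) ^+ p.
Let B (x : Cspace R n) : R[i] := (x 0 l : R[i]) ^+ r.

Hypothesis fE : near0 (fun x => h x = 0 ->
  e x * f x = \sum_(m < k.+1) q m x * A x ^+ m * B x ^+ (k - m)).

Let sum_q0 (F : nat -> R[i]) : \sum_(m < k.+1) q m 0 * F m = c * F 0%N + c * F k.
Proof.
rewrite (bigD1 ord_max) //= (bigD1 ord0) /=; last by rewrite -val_eqE /= neq_ltn k0.
rewrite !q0 // eqxx orbT addrC big1 ?addr0 // => m /andP[mk m0].
have /negPf mk' : (m != k :> nat) by apply: contra mk => /eqP mk; apply/eqP/val_inj.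
have /negPf m0' : (m != 0%N :> nat) by apply: contra m0 => /eqP m0; apply/eqP/val_inj.
by rewrite q0 ?mk' ?m0' ?mul0r // -ltnS.
Qed.

(** The [p]-th root [t] of [s] serves to parametrize the curve [x_j^p = s x_l^r]. *)
Let root (t0 : R[i]) : t0 ^+ k = -1 -> exists s t,
  [/\ anal s, anal t, s 0 = t0, near0 (fun x => \sum_(m < k.+1) q m x * s x ^+ m = 0) &
      near0 (fun x => t x ^+ p = s x)].
Proof.
move=> tk.
have t00 : t0 != 0.
  apply/negP => /eqP t00; move: tk; rewrite t00 expr0n gtn_eqF // => /eqP.
  by rewrite eq_sym oppr_eq0 oner_eq0.
have [||s [sa s0 se]] := @anal_root R n q k.+1 t0 qa.
- by rewrite (sum_q0 (fun m => t0 ^+ m)) tk expr0 mulr1 mulrN1 subrr.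
- under eq_bigr do rewrite -mulrnAr.
  rewrite (sum_q0 (fun m => t0 ^+ m.-1 *+ m)) mulr0n mulr0 add0r mulf_neq0 //.
  by rewrite mulrn_eq0 negb_or -lt0n k0 expf_neq0.
have s0' : s 0 != 0 by rewrite s0.
have [t [ta _ te]] := anal_nthroot sa p0 (rootCK p0 (s 0)) s0'.
by exists s, t.
Qed.

(** The curve is [x_l = s^p], [x_j = s^r t], [x_i = - (v x_j + w x_l) / u] with a small parameter
    [s]. As [t], [u], [v], [w] depend on [x], this is an equation for [x], of the kind [curve_point]
    solves. *)
Let point (t : Cspace R n -> R[i]) (d : R) : anal t -> 0 < d ->
  exists2 x, in_pd d x & [/\ h x = 0, A x = t x ^+ p * B x & B x != 0].
Proof.
move=> ta d0; have [t' t'a ut] := anal_inv ua u0.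
have [d1 /andP[d10 d1d] hd1] := near0_ball d0 (near0_and ut hE).
pose G m : Cspace R n -> R[i] := if m == i then fun x => - (t' x * v x * t x)
  else if m == j then t else fun=> 0.
pose G' m : Cspace R n -> R[i] := if m == i then fun x => - (t' x * w x)
  else if m == l then fun=> 1 else fun=> 0.
have Ga m : anal (G m).
  rewrite /G; case: ifP => _; first by apply: analN; do !apply: analM.
  by case: ifP => _ //; exact: anal_cst.
have G'a m : anal (G' m).
  rewrite /G'; case: ifP => _; first by apply: analN; apply: analM.
  by case: ifP => _; exact: anal_cst.
have [s s0 [x xd xE]] := @curve_point R n G G' (fun=> r) (fun=> p) d1 d10 Ga G'a
  (fun=> r0) (fun=> p0).
exists x; first by move=> m; apply: le_trans (xd m) d1d.
have [ut1 hx] := hd1 x xd.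
have xi : (x 0 i : R[i]) = - (s ^+ r * (t' x * v x * t x) + s ^+ p * (t' x * w x)).
  by rewrite xE /G /G' eqxx; ring.
have xj : (x 0 j : R[i]) = s ^+ r * t x.
  by rewrite xE /G /G' [j == i]eq_sym (negPf ij) eqxx (negPf jl) mulr0 addr0.
have xl : (x 0 l : R[i]) = s ^+ p.
  by rewrite xE /G /G' ![l == _]eq_sym (negPf il) (negPf jl) eqxx mulr0 add0r mulr1.
split.
- rewrite hx xi xj xl.
  transitivity ((1 - u x * t' x) * (s ^+ r * t x * v x + s ^+ p * w x)); first by ring.
  by rewrite ut1 subrr mul0r.
- by rewrite /A /B xj xl exprMn -!exprM mulrC [(r * p)%N]mulnC.
- by rewrite /B xl -exprM expf_neq0.
Qed.

(** The two components are [A = s B] and [Q = 0]. The first misses the curve of a second root [s'].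
    The second misses the curve of [s] itself, because [s] is a simple root. *)
Lemma reducible_section Z : near0 (fun x => Z x <-> f x = 0 /\ h x = 0) ->
  reducible_germ Z.
Proof.
move=> hZ; pose t0 : R[i] := k.-root (-1).
have tk : t0 ^+ k = -1 by rewrite rootCK.
have [s [t [sa ta s0 se te]]] := root tk.
have [s' [t' [s'a t'a s'0 s'e t'e]]] : exists s' t',
  [/\ anal s', anal t', s' 0 = - t0,
    near0 (fun x => \sum_(m < k.+1) q m x * s' x ^+ m = 0) &
    near0 (fun x => t' x ^+ p = s' x)].
  (* [k] is even, so [- t0] is a root too. *)
  by apply: root; rewrite exprNn -signr_odd (negPf k2) expr0 mul1r.
have t00 : t0 != 0.
  apply/negP => /eqP t00; move: tk; rewrite t00 expr0n gtn_eqF // => /eqP.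
  by rewrite eq_sym oppr_eq0 oner_eq0.
(* The cofactor of [A - s B]: subtracting [B^k sum_m q_m s^m = 0] turns each [A^m] into
   [A^m - (s B)^m], which [A - s B] divides. *)
pose Q x := \sum_(m < k.+1) q m x * B x ^+ (k - m) *
  \sum_(b < m) A x ^+ (m.-1 - b) * (s x * B x) ^+ b.
have Aa : anal A by apply: analX; exact: anal_coord.
have Ba : anal B by apply: analX; exact: anal_coord.
have Qa : anal Q.
  apply: anal_sum => m; apply: analM; first by apply: analM => //; exact: analX.
  apply: anal_sum => b; apply: analM; first exact: analX.
  by apply: analX; exact: analM.
have Bk x (m : 'I_k.+1) : B x ^+ k = B x ^+ (k - m) * B x ^+ m.
  by rewrite -exprD subnK // -ltnS.
have hom x z : A x = z * B x ->
    \sum_(m < k.+1) q m x * A x ^+ m * B x ^+ (k - m) =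
    B x ^+ k * \sum_(m < k.+1) q m x * z ^+ m.
  move=> ->; rewrite mulr_sumr; apply: eq_bigr => m _.
  by rewrite exprMn (Bk x m); ring.
have fact x : \sum_(m < k.+1) q m x * s x ^+ m = 0 ->
    \sum_(m < k.+1) q m x * A x ^+ m * B x ^+ (k - m) = (A x - s x * B x) * Q x.
  move=> sx; transitivity (\sum_(m < k.+1) q m x * A x ^+ m * B x ^+ (k - m) -
      B x ^+ k * \sum_(m < k.+1) q m x * s x ^+ m); first by rewrite sx mulr0 subr0.
  rewrite [X in _ - X]mulr_sumr -sumrB mulr_sumr; apply: eq_bigr => m _.
  by rewrite [RHS]mulrCA -subrXX exprMn (Bk x m); ring.
have dif : near0 (fun x => s' x - s x != 0).
  apply: anal_neq0; first exact: analB.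
  by rewrite s'0 s0 -opprD oppr_eq0 -mulr2n mulrn_eq0.
(* The derivative of the polynomial at its root [s]. Where [A = s B], [Q] equals [B^(k-1) N]. *)
pose N x := \sum_(m < k.+1) (q m x * s x ^+ m.-1) *+ m.
have NN : near0 (fun x => N x != 0).
  apply: anal_neq0.
    apply: anal_sum => m; apply: anal_ext (analM (analM (qa m) (analX m.-1 sa))
      (anal_cst n (m%:R))) => x; by rewrite mulr_natr.
  rewrite /N; under eq_bigr do rewrite -mulrnAr.
  rewrite (sum_q0 (fun m => s 0 ^+ m.-1 *+ m)) mulr0n mulr0 add0r mulf_neq0 //.
  by rewrite mulrn_eq0 negb_or -lt0n k0 expf_neq0 // s0.
have en : near0 (fun x => e x != 0) by exact: anal_neq0.
have inZ x z : h x = 0 -> (h x = 0 -> e x * f x =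
      \sum_(m < k.+1) q m x * A x ^+ m * B x ^+ (k - m)) -> e x != 0 ->
    A x = z * B x -> \sum_(m < k.+1) q m x * z ^+ m = 0 -> f x = 0.
  move=> hx /(_ hx) + ex Az qz; rewrite (hom _ _ Az) qz mulr0 => /eqP.
  by rewrite mulf_eq0 (negPf ex) => /eqP.
exists [set x | h x = 0 /\ A x - s x * B x = 0], [set x | h x = 0 /\ Q x = 0]; split.
- by apply: analytic_germ2 => //; apply: analB => //; exact: analM.
- exact: analytic_germ2.
- apply/germ_eqP; apply: near0_imp (near0_and (near0_and hZ fE) (near0_and se en)).
  move=> x [[Zx fx] [sx ex]]; rewrite Zx /=; split=> [[fx0 hx]|].
    move: (fx hx); rewrite fx0 mulr0 (fact _ sx) => /esym/eqP; rewrite mulf_eq0.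
    by case/orP => /eqP; [left|right].
  have main : h x = 0 -> (A x - s x * B x) * Q x = 0 -> f x = 0 /\ h x = 0.
    move=> hx; rewrite -(fact _ sx) -(fx hx) => /eqP; rewrite mulf_eq0 (negPf ex).
    by move=> /eqP.
  by move=> [[hx z]|[hx z]]; apply: main => //; rewrite z ?mul0r ?mulr0.
- move/germ_eqP => hA.
  have [d d0 hd] := near0_and (near0_and (near0_and hZ fE) (near0_and s'e en))
    (near0_and (near0_and hA dif) t'e).
  have [x xd [hx Ax Bx]] := point t'a d0.
  have [[[Zx fx] [sx ex]] [[Axx dx] tx]] := hd x xd; rewrite tx in Ax.
  have /Axx[_] : Z x by apply/Zx; split=> //; exact: inZ Ax sx.
  rewrite Ax -mulrBl => /eqP; rewrite mulf_eq0.
  by rewrite (negPf dx) (negPf Bx).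
- move/germ_eqP => hA.
  have [d d0 hd] := near0_and (near0_and (near0_and hZ fE) (near0_and se en))
    (near0_and (near0_and hA NN) te).
  have [x xd [hx Ax Bx]] := point ta d0.
  have [[[Zx fx] [sx ex]] [[Axx Nx] tx]] := hd x xd; rewrite tx in Ax.
  have /Axx[_] : Z x by apply/Zx; split=> //; exact: inZ Ax sx.
  have -> : Q x = B x ^+ k.-1 * N x.
    rewrite /Q /N mulr_sumr; apply: eq_bigr => m _.
    case: m => -[|m] /= mk; first by rewrite big_ord0 !mulr0n !mulr0.
    under eq_bigr => b _ do rewrite Ax -exprD subnK -1?ltnS //.
    have -> : k.-1 = (k - m.+1 + m)%N by clear -mk; lia.
    rewrite sumr_const card_ord exprMn exprD !mulrnAr; congr (_ *+ _).
    by rewrite mulrACA mulrC.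
  by move=> /eqP; rewrite mulf_eq0 expf_eq0 (negPf Bx) andbF (negPf Nx).
Qed.

End Main.
End Sections.

(** * Terms that leave the leading form unchanged *)

Section Perturbation.
Variables (R : realType) (n : nat) (j l : 'I_n) (p r k : nat).
Implicit Types (f g C : Cspace R n -> R[i]).

(** Adding such a [g] changes the coefficients of the form only by functions vanishing at 0, so [q0]
    is preserved. *)
Definition perturbation g := exists W : nat -> Cspace R n -> R[i],
  [/\ forall m, anal (W m), forall m, W m 0 = 0 &
      forall x, g x = \sum_(m < k.+1) W m x * ((x 0 j : R[i]) ^+ p) ^+ m *
        ((x 0 l : R[i]) ^+ r) ^+ (k - m)].

Lemma perturbation0 : perturbation (fun=> 0).
Proof.
exists (fun _ _ => 0); split=> // [m|x]; first exact: anal_cst.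
by rewrite big1 // => m _; rewrite !mul0r.
Qed.

Lemma perturbationD f g : perturbation f -> perturbation g ->
  perturbation (fun x => f x + g x).
Proof.
move=> [V [Va V0 fE]] [W [Wa W0 gE]]; exists (fun m x => V m x + W m x); split.
- by move=> m; apply: analD.
- by move=> m; rewrite V0 W0 addr0.
- by move=> x; rewrite fE gE -big_split; apply: eq_bigr => m _; rewrite !mulrDl.
Qed.

Lemma perturbation_sum N (g : nat -> Cspace R n -> R[i]) :
  (forall t, (t < N)%N -> perturbation (g t)) ->
  perturbation (fun x => \sum_(t < N) g t x).
Proof.
elim: N => [|N IH] gt.
  have -> : (fun x => \sum_(t < 0) g t x) = (fun=> 0).
    by apply/funext => x; rewrite big_ord0.
  exact: perturbation0.
have -> : (fun x => \sum_(t < N.+1) g t x) = (fun x => \sum_(t < N) g t x + g N x).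
  by apply/funext => x; rewrite big_ord_recr.
by apply: perturbationD; [apply: IH => t tN; apply: gt; apply: ltnW|exact: gt].
Qed.

Lemma perturbation_ext f g : f =1 g -> perturbation f -> perturbation g.
Proof. by move=> /funext ->. Qed.

(* [A^m B^(k-m)], with [A = x_j^p] and [B = x_l^r], properly divides [x_j^a x_l^b]. *)
Definition above (a b : nat) := has (fun m => [&& (p * m <= a)%N, (r * (k - m) <= b)%N &
  (p * m + r * (k - m) < a + b)%N]) (iota 0 k.+1).

(** The monomial is charged to a single [m]. Proper divisibility leaves a positive power of a
    coordinate in its coefficient, which therefore vanishes at 0. *)
Lemma perturbation_mon C a b : anal C -> above a b ->
  perturbation (fun x => C x * (x 0 j : R[i]) ^+ a * (x 0 l : R[i]) ^+ b).
Proof.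
move=> Ca /hasP[m]; rewrite mem_iota add0n => /andP[_ mk] /and3P[ma mb mab].
pose V x := C x * (x 0 j : R[i]) ^+ (a - p * m) * (x 0 l : R[i]) ^+ (b - r * (k - m)).
exists (fun m' => if m' == m then V else fun=> 0); split.
- move=> m'; case: ifP => _; last exact: anal_cst.
  by do !apply: analM => //; apply: analX; exact: anal_coord.
- move=> m'; case: ifP => _ //; rewrite /V !mxE !expr0n.
  have : (0 < a - p * m)%N || (0 < b - r * (k - m))%N by lia.
  by case/orP => /gtn_eqF ->; rewrite ?mulr0 ?mul0r.
- move=> x; rewrite (bigD1 (Ordinal mk)) //= eqxx big1 ?addr0 => [|m' m'm]; last first.
    by rewrite (_ : (m' == m :> nat) = false) ?mul0r //; apply/negbTE.
  rewrite /V -!exprM -{1}(subnK ma) -{1}(subnK mb) !exprD; ring.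
Qed.

End Perturbation.

(** * The three eliminations *)

Section Cases.
Variable R : realType.
Implicit Types (h u v w a b c : Cspace R 3 -> R[i]) (Z : set (Cspace R 3)).

Definition brieskorn (x : Cspace R 3) : R[i] :=
  (x 0 (inord 0) : R[i]) ^+ 40 + (x 0 (inord 1) : R[i]) ^+ 30 + (x 0 (inord 2) : R[i]) ^+ 24.

(** In the applications [e] is the power of [u] that clears denominators when [x_i] is eliminated;
    it becomes both end coefficients of the form. *)
Lemma reducible_perturbation h u v w (e : Cspace R 3 -> R[i]) (i j l : 'I_3) p r k g Z :
  anal h -> anal u -> anal v -> anal w -> anal e -> i != j -> i != l -> j != l ->
  (0 < p)%N -> (0 < r)%N -> (0 < k)%N -> ~~ odd k -> u 0 != 0 -> e 0 != 0 ->
  near0 (fun x => h x =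
    (x 0 i : R[i]) * u x + (x 0 j : R[i]) * v x + (x 0 l : R[i]) * w x) ->
  perturbation j l p r k g ->
  near0 (fun x => h x = 0 -> e x * brieskorn x =
     e x * ((x 0 j : R[i]) ^+ p) ^+ k + e x * ((x 0 l : R[i]) ^+ r) ^+ k + g x) ->
  near0 (fun x => Z x <-> brieskorn x = 0 /\ h x = 0) -> reducible_germ Z.
Proof.
move=> ha ua va wa ea ij il jl p0 r0 k0 k2 u0 e0 hE [W [Wa W0 gE]] fE.
pose q m (x : Cspace R 3) := W m x + ((m == 0%N) || (m == k))%:R * e x.
have qa m : anal (q m) by apply: analD => //; apply: analM => //; exact: anal_cst.
apply: (@reducible_section R 3 brieskorn h u v w e i j l p r k q (e 0)) => //.
  by move=> m _; rewrite /q W0 add0r; case: (_ || _); rewrite ?mul1r ?mul0r.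
apply: near0_imp fE => x fx hx; rewrite (fx hx) gE.
under [RHS]eq_bigr do rewrite /q 2!mulrDl.
rewrite big_split /= addrC; congr (_ + _).
rewrite (bigD1 ord_max) //= (bigD1 ord0) /=; last by rewrite -val_eqE /= neq_ltn k0.
rewrite big1 => [|m /andP[mk m0]].
  by rewrite !eqxx orbT !mul1r subnn subn0 !expr0 !mulr1 addr0.
have /negPf -> : (m != k :> nat) by apply: contra mk => /eqP mk; apply/eqP/val_inj.
have /negPf -> : (m != 0%N :> nat) by apply: contra m0 => /eqP m0; apply/eqP/val_inj.
by rewrite !mul0r.
Qed.

Let i0 : 'I_3 := inord 0.
Let i1 : 'I_3 := inord 1.
Let i2 : 'I_3 := inord 2.

Let i01 : i0 != i1. Proof. by rewrite -val_eqE /= !inordK. Qed.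
Let i02 : i0 != i2. Proof. by rewrite -val_eqE /= !inordK. Qed.
Let i12 : i1 != i2. Proof. by rewrite -val_eqE /= !inordK. Qed.

Let sum3 (F : 'I_3 -> R[i]) : \sum_i F i = F i0 + F i1 + F i2.
Proof.
rewrite !big_ord_recl big_ord0 addr0 addrA.
by congr (F _ + F _ + F _); apply: val_inj; rewrite /= inordK.
Qed.

Let pow_opp (x y : R[i]) m : ~~ odd m -> x + y = 0 -> x ^+ m = y ^+ m.
Proof.
move=> om /eqP; rewrite addr_eq0 => /eqP ->.
by rewrite exprNn -signr_odd (negPf om) expr0 mul1r.
Qed.

Let term (x b y c : R[i]) s t N : (x * b) ^+ s * (y * c) ^+ t *+ N =
  (b ^+ s * c ^+ t * N%:R) * x ^+ s * y ^+ t.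
Proof.
rewrite -mulr_natr !exprMn.
move: (x ^+ s) (b ^+ s) (y ^+ t) (c ^+ t) (N%:R) => X B' Y C' M; ring.
Qed.

Let term2 (x y A D B : R[i]) m t s N K :
  (x ^+ 2 * A) ^+ m * (y ^+ t * ((x * D) ^+ (t - s) * (y * B) ^+ s *+ K)) *+ N =
  A ^+ m * D ^+ (t - s) * B ^+ s * (N * K)%:R * x ^+ (2 * m + (t - s)) * y ^+ (t + s).
Proof.
rewrite (term x D y B (t - s) s K) -mulr_natr natrM.
rewrite (exprMn m (x ^+ 2) A) -(exprM x 2 m) (exprD x) (exprD y).
move: (A ^+ m) (D ^+ (t - s)) (B ^+ s) (N%:R) (K%:R) (x ^+ (2 * m)) (x ^+ (t - s))
  (y ^+ t) (y ^+ s) => q1 q2 q3 q4 q5 q6 q7 q8 q9; ring.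
Qed.

(** With opaque [E X Y W], [ring] never meets the exponents 40, 30 and 24. *)
Let isolate_x (E X Y W : R[i]) : E * (X + Y + W) = E * Y + E * W + X * E.
Proof. ring. Qed.

Let isolate_y (E X Y W : R[i]) : E * (X + Y + W) = E * X + E * W + Y * E.
Proof. ring. Qed.

Let isolate_z (E X Y W : R[i]) : E * (X + Y + W) = E * X + E * Y + W * E.
Proof. ring. Qed.

(** On [Y], [(x a)^40 = (y b + z c)^40]. Its monomials have weight at least 160, against 120 for the
    form in [y^5] and [z^4]. *)
Lemma reducible_case1 h a b c Z : anal h -> anal a -> anal b -> anal c -> a 0 != 0 ->
  near0 (fun x => h x =
    (x 0 i0 : R[i]) * a x + (x 0 i1 : R[i]) * b x + (x 0 i2 : R[i]) * c x) ->
  near0 (fun x => Z x <-> brieskorn x = 0 /\ h x = 0) -> reducible_germ Z.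
Proof.
move=> ha aa ba ca a0 hE.
apply: (@reducible_perturbation h a b c (fun x => a x ^+ 40) i0 i1 i2 5 4 6
  (fun x => ((x 0 i1 : R[i]) * b x + (x 0 i2 : R[i]) * c x) ^+ 40)) => //.
- exact: analX.
- by rewrite expf_neq0.
- apply: perturbation_ext (_ : perturbation i1 i2 5 4 6 (fun x => \sum_(t < 41)
      (b x ^+ (40 - t) * c x ^+ t * 'C(40, t)%:R) * (x 0 i1 : R[i]) ^+ (40 - t) *
        (x 0 i2 : R[i]) ^+ t)).
    move=> x; rewrite exprDn; apply: eq_bigr => t _.
    by rewrite (term _ (b x) _ (c x)).
  apply: (perturbation_sum (g := fun t x => (b x ^+ (40 - t) * c x ^+ t * 'C(40, t)%:R) *
    (x 0 i1 : R[i]) ^+ (40 - t) * (x 0 i2 : R[i]) ^+ t)) => t t41.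
  apply: perturbation_mon.
    by apply: analM; [apply: analM; exact: analX|exact: anal_cst].
  (* Weights alone do not give divisibility, so every monomial is checked. *)
  have : all (fun t => above 5 4 6 (40 - t) t) (iota 0 41) by vm_compute.
  by move/allP; apply; rewrite mem_iota.
- apply: near0_imp hE => x -> /eqP; rewrite -addrA => /eqP hx.
  rewrite -(pow_opp (m := 40) _ hx) // /brieskorn.
  by rewrite [((x 0 i0 : R[i]) * _) ^+ 40]exprMn -!exprM; exact: isolate_x.
Qed.

(** Here the coefficient of [x] vanishes at 0. The terms [x y] and [x z] are absorbed into [b'] and
    [c'], so on [Y] [y b' = - (x^2 a1 + z c')], and the 30th power has weight at least 150. *)
Lemma reducible_case2 h a1 a2 a3 b c Z : anal h -> anal a1 -> anal a2 -> anal a3 ->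
  anal b -> anal c -> b 0 != 0 ->
  near0 (fun x => h x =
    (x 0 i0 : R[i]) * ((x 0 i0 : R[i]) * a1 x + (x 0 i1 : R[i]) * a2 x + (x 0 i2 : R[i]) * a3 x) +
    (x 0 i1 : R[i]) * b x + (x 0 i2 : R[i]) * c x) ->
  near0 (fun x => Z x <-> brieskorn x = 0 /\ h x = 0) -> reducible_germ Z.
Proof.
move=> ha a1a a2a a3a ba ca b0 hE.
have co i := @anal_coord R 3 i.
pose b' x := b x + (x 0 i0 : R[i]) * a2 x.
pose c' x := c x + (x 0 i0 : R[i]) * a3 x.
have b'a : anal b' by apply: analD => //; apply: analM.
have c'a : anal c' by apply: analD => //; apply: analM.
apply: (@reducible_perturbation h b'
  (fun x => (x 0 i0 : R[i]) * a1 x) c' (fun x => b' x ^+ 30) i1 i0 i2 5 3 8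
  (fun x => ((x 0 i0 : R[i]) ^+ 2 * a1 x + (x 0 i2 : R[i]) * c' x) ^+ 30)) => //.
- by apply: analM.
- exact: analX.
- by rewrite eq_sym.
- by rewrite /b' mxE mul0r addr0.
- by rewrite expf_neq0 // /b' mxE mul0r addr0.
- by apply: near0_imp hE => x ->; rewrite /b' /c'; ring.
- apply: perturbation_ext (_ : perturbation i0 i2 5 3 8 (fun x => \sum_(t < 31)
      (a1 x ^+ (30 - t) * c' x ^+ t * 'C(30, t)%:R) * (x 0 i0 : R[i]) ^+ (2 * (30 - t)) *
        (x 0 i2 : R[i]) ^+ t)).
    move=> x; rewrite exprDn; apply: eq_bigr => t _.
    by rewrite (term _ (a1 x) _ (c' x)) -exprM.
  apply: (perturbation_sum (g := fun t x => (a1 x ^+ (30 - t) * c' x ^+ t * 'C(30, t)%:R) *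
    (x 0 i0 : R[i]) ^+ (2 * (30 - t)) * (x 0 i2 : R[i]) ^+ t)) => t t31.
  apply: perturbation_mon.
    by apply: analM; [apply: analM; exact: analX|exact: anal_cst].
  have : all (fun t => above 5 3 8 (2 * (30 - t)) t) (iota 0 31) by vm_compute.
  by move/allP; apply; rewrite mem_iota.
- apply: near0_imp hE => x -> hx.
  have hx' : (x 0 i1 : R[i]) * b' x +
      ((x 0 i0 : R[i]) ^+ 2 * a1 x + (x 0 i2 : R[i]) * c' x) = 0.
    by rewrite -hx /b' /c'; ring.
  rewrite -(pow_opp (m := 30) _ hx') // /brieskorn.
  by rewrite [((x 0 i1 : R[i]) * _) ^+ 30]exprMn -!exprM; exact: isolate_y.
Qed.

(** The coefficients of [x] and [y] vanish at 0. After absorbing [x z] and [y z], [z c'] is minus a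
    quadratic form in [x] and [y] with analytic coefficients; its 24th power has degree 48, hence
    weight at least 144. *)
Lemma reducible_case3 h a1 a2 a3 b1 b2 b3 c Z : anal h -> anal a1 -> anal a2 -> anal a3 ->
  anal b1 -> anal b2 -> anal b3 -> anal c -> c 0 != 0 ->
  near0 (fun x => h x =
    (x 0 i0 : R[i]) * ((x 0 i0 : R[i]) * a1 x + (x 0 i1 : R[i]) * a2 x + (x 0 i2 : R[i]) * a3 x) +
    (x 0 i1 : R[i]) * ((x 0 i0 : R[i]) * b1 x + (x 0 i1 : R[i]) * b2 x + (x 0 i2 : R[i]) * b3 x) +
    (x 0 i2 : R[i]) * c x) ->
  near0 (fun x => Z x <-> brieskorn x = 0 /\ h x = 0) -> reducible_germ Z.
Proof.
move=> ha a1a a2a a3a b1a b2a b3a ca c0 hE.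
have co i := @anal_coord R 3 i.
pose c' x := c x + (x 0 i0 : R[i]) * a3 x + (x 0 i1 : R[i]) * b3 x.
pose d x := a2 x + b1 x.
have c'a : anal c' by apply: analD; [apply: analD => //|]; apply: analM.
have da : anal d by exact: analD.
have c'0 : c' 0 != 0 by rewrite /c' !mxE !mul0r !addr0.
apply: (@reducible_perturbation h c'
  (fun x => (x 0 i0 : R[i]) * a1 x + (x 0 i1 : R[i]) * d x)
  (fun x => (x 0 i1 : R[i]) * b2 x) (fun x => c' x ^+ 24) i2 i0 i1 4 3 10
  (fun x => ((x 0 i0 : R[i]) ^+ 2 * a1 x +
     (x 0 i1 : R[i]) * ((x 0 i0 : R[i]) * d x + (x 0 i1 : R[i]) * b2 x)) ^+ 24)) => //.
- by apply: analD; apply: analM.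
- exact: analM.
- exact: analX.
- by rewrite eq_sym.
- by rewrite eq_sym.
- by rewrite expf_neq0.
- by apply: near0_imp hE => x ->; rewrite /c' /d; ring.
- pose V t s x := a1 x ^+ (24 - t) * d x ^+ (t - s) * b2 x ^+ s *
    ('C(24, t) * 'C(t, s))%:R.
  pose g t s x := V t s x * (x 0 i0 : R[i]) ^+ (2 * (24 - t) + (t - s)) *
    (x 0 i1 : R[i]) ^+ (t + s).
  apply: perturbation_ext (_ : perturbation i0 i1 4 3 10
    (fun x => \sum_(t < 25) \sum_(s < t.+1) g t s x)).
    move=> x; rewrite [RHS]exprDn; apply: eq_bigr => t _.
    rewrite [((x 0 i1 : R[i]) * _) ^+ t]exprMn [X in _ = _ * (_ * X) *+ _]exprDn.
    rewrite mulr_sumr mulr_sumr -sumrMnl.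
    by apply: eq_bigr => s _; rewrite /g /V -term2.
  apply: (perturbation_sum (g := fun t x => \sum_(s < t.+1) g t s x)) => t t25.
  apply: perturbation_sum => s st; apply: perturbation_mon.
    apply: analM; last exact: anal_cst.
    by do 2?apply: analM; exact: analX.
  have : all (fun t => all (fun s => above 4 3 10 (2 * (24 - t) + (t - s)) (t + s))
    (iota 0 t.+1)) (iota 0 25) by vm_compute.
  move/allP => /(_ t); rewrite mem_iota => /(_ t25)/allP; apply.
  by rewrite mem_iota.
- apply: near0_imp hE => x -> hx.
  have hx' : (x 0 i2 : R[i]) * c' x + ((x 0 i0 : R[i]) ^+ 2 * a1 x +
     (x 0 i1 : R[i]) * ((x 0 i0 : R[i]) * d x + (x 0 i1 : R[i]) * b2 x)) = 0.
    by rewrite -hx /c' /d; ring.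
  rewrite -(pow_opp (m := 24) _ hx') // /brieskorn.
  by rewrite [((x 0 i2 : R[i]) * _) ^+ 24]exprMn -!exprM; exact: isolate_z.
Qed.

(** Coordinates are tried in order of increasing weight. A coefficient that vanishes at 0 is divided
    once more by the coordinates, which makes its coordinate enter [h] only quadratically. *)
Lemma reducible_smooth h (g : 'I_3 -> Cspace R 3 -> R[i]) Z : anal h ->
  (forall i, anal (g i)) -> (exists i, g i 0 != 0) ->
  near0 (fun x => h x = \sum_i (x 0 i : R[i]) * g i x) ->
  near0 (fun x => Z x <-> brieskorn x = 0 /\ h x = 0) -> reducible_germ Z.
Proof.
move=> ha ga [i gi] hE.
have hE' : near0 (fun x => h x = (x 0 i0 : R[i]) * g i0 x + (x 0 i1 : R[i]) * g i1 x +
    (x 0 i2 : R[i]) * g i2 x) by apply: near0_imp hE => x ->; rewrite sum3.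
have [a0|a0] := eqVneq (g i0 0) 0; last exact: (reducible_case1 ha (ga i0) (ga i1) (ga i2)).
have [a [aa aE]] := anal_hadamard (ga i0).
have [b0|b0] := eqVneq (g i1 0) 0; last first.
  apply: (reducible_case2 ha (aa i0) (aa i1) (aa i2) (ga i1) (ga i2) b0).
  by apply: near0_imp (near0_and hE' aE) => x [-> ->]; rewrite sum3 a0 add0r.
have [b [ba bE]] := anal_hadamard (ga i1).
apply: (reducible_case3 ha (aa i0) (aa i1) (aa i2) (ba i0) (ba i1) (ba i2) (ga i2)).
  apply: contraNneq gi => c0; have : (i == i0) || (i == i1) || (i == i2).
    by rewrite -!val_eqE /= !inordK //; case: i => -[|[|[|]]].
  by case/orP => [/orP[]|] /eqP ->; apply/eqP.
apply: near0_imp (near0_and hE' (near0_and aE bE)) => x [-> [-> ->]].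
by rewrite !sum3 a0 b0 !add0r.
Qed.

End Cases.

(** * A chart coordinate has nonzero differential *)

Section Chart.
Variables (R : realType) (n : nat).

Lemma anal_ps (a : Defs.pseries R n) : convergent a -> anal (ps_eval a).
Proof. by move=> ca; exists a => //; exact: near0_all. Qed.

(** A metric argument in place of the chain rule. If every [g_j] vanished at 0, they would all be
    below [1 / (S + 1)] near 0, with [S] the sum of Lipschitz constants of [Psi]. At the point
    [x = t e_i] this gives [t = |Phi_i(Psi(x))| <= S t / (S + 1) < t]. *)
Lemma chart_coordinate (Phi Psi : 'I_n -> Defs.pseries R n) (i : 'I_n) :
  biholomorphic_germ Phi Psi -> exists g : 'I_n -> Cspace R n -> R[i],
  [/\ forall j, anal (g j), exists j, g j 0 != 0 &
    near0 (fun x => ps_eval (Phi i) x = \sum_j (x 0 j : R[i]) * g j x)].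
Proof.
move=> [cPhi cPsi [Phi0 Psi0] _ /near0P inv].
have phi0 : ps_eval (Phi i) 0 = 0 by move/rowP: Phi0 => /(_ i); rewrite !mxE.
have psi0 j : ps_eval (Psi j) 0 = 0 by move/rowP: Psi0 => /(_ j); rewrite !mxE.
have [g [ga gE]] := anal_hadamard (anal_ps (cPhi i)).
exists g; split=> //; last first.
  by apply: near0_imp gE => x ->; rewrite phi0 add0r.
apply: contrapT => g0'.
have g0 j : g j 0 = 0.
  by apply/eqP; apply: contrapT => /negP gj; apply: g0'; exists j.
have lipj j : exists rL : R * R, [/\ 0 < rL.1, 0 < rL.2 & forall x d, 0 <= d ->
    in_pd rL.1 x -> in_pd d x -> nm (ps_eval (Psi j) x) <= rL.2 * d].
  have [r [L [r0 L0 h]]] := anal_lip (anal_ps (cPsi j)).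
  exists (r, L); split=> // x d d0 xr xd /=.
  have := h x 0 d d0 xr; rewrite psi0 subr0; apply.
    by move=> k; rewrite mxE nm0 ltW.
  by move=> k; rewrite mxE subr0; exact: xd.
pose rL j := proj1_sig (cid (lipj j)).
have rLP j : [/\ 0 < (rL j).1, 0 < (rL j).2 & forall x d, 0 <= d ->
    in_pd (rL j).1 x -> in_pd d x -> nm (ps_eval (Psi j) x) <= (rL j).2 * d].
  by rewrite /rL; case: cid.
pose S : R := \sum_j (rL j).2.
have S0 : 0 <= S by apply: sumr_ge0 => j _; have [_ /ltW] := rLP j.
have e0 : 0 < (S + 1)^-1 by rewrite invr_gt0 ltr_wpDl.
have small : near0 (fun x => forall j, nm (g j x) < (S + 1)^-1).
  apply: near0_forall => j; apply: near0_imp (anal_cont (ga j) e0) => x.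
  by rewrite g0 subr0.
have [d d0 hd] := near0_and small gE.
have [d' d'0 hd'] : near0 (fun x : Cspace R n => forall j, in_pd (rL j).1 x).
  by apply: near0_forall => j; have [h _ _] := rLP j; exists (rL j).1.
have [b b0 hb] := inv.
(* Small enough that [Psi x] stays in the polydisc of radius [d]. *)
pose t : R := Num.min (d / (S + 1)) (Num.min d' b).
have t0 : 0 < t by rewrite !lt_min divr_gt0 ?d'0 //; lra.
have tb : t <= b by rewrite !ge_min lexx !orbT.
have td' : t <= d' by rewrite !ge_min lexx !orbT.
have td : t * (S + 1) <= d by rewrite -ler_pdivlMr ?ge_min ?lexx //; lra.
pose x : Cspace R n := \row_j (if j == i then t%:C else 0 : R[i]^o).
have xt : in_pd t x.
  move=> j; rewrite mxE; case: ifP => _; last by rewrite nm0 ltW.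
  by rewrite nmR // ltW.
have psix j : nm (ps_eval (Psi j) x) <= (rL j).2 * t.
  have [_ _ h] := rLP j; apply: h => //; first exact: ltW.
  by apply: hd' => k; apply: le_trans (xt k) td'.
have psid : in_pd d (ps_map Psi x).
  move=> j; rewrite mxE; apply: le_trans (psix j) _; apply: le_trans td.
  rewrite mulrC; apply: ler_wpM2l; first exact: ltW.
  rewrite /S (bigD1 j) //= -addrA lerDl addr_ge0 // sumr_ge0 // => k _.
  by have [_ /ltW] := rLP k.
have [gs ps] := hd _ psid.
have /rowP/(_ i) : ps_map Phi (ps_map Psi x) = x.
  by apply: hb => j; apply: le_trans (xt j) tb.
rewrite !mxE eqxx ps phi0 add0r => e.
have : nm (t%:C) <= S * t * (S + 1)^-1.
  rewrite -e; apply: le_trans (nm_sum _ _ _) _; rewrite /S !mulr_suml.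
  apply: ler_sum => j _; rewrite nmM mxE; apply: ler_pM => //; exact: ltW (gs j).
rewrite nmR ?(ltW t0) // ler_pdivlMr; last by lra.
lra.
Qed.

End Chart.

(** * Weighted homogeneous parts *)

Section Weights.
Variables (R : realType) (n : nat) (w : 'I_n -> nat).
Hypothesis w0 : forall i, (0 < w i)%N.
Implicit Types (m : multi_index n) (a : multi_index n -> R[i]) (P : Cspace R n).
Implicit Types (s : R[i]) (r M : R).

Definition wdeg (m : multi_index n) : nat := (\sum_i w i * m i)%N.

(** A polynomial in [P], defined on all of C^n. As the weights are positive, the box of side [K.+1]
    holds every monomial of weighted degree [K]. *)
Definition wpart a (K : nat) P : R[i] :=
  \sum_(m <- bx n K.+1 | wdeg m == K) a m * mon P m.

Definition wact s P : Cspace R n := \row_i (s ^+ w i * (P 0 i : R[i]) : R[i]^o).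

Lemma mon_wact s P m : mon (wact s P) m = s ^+ wdeg m * mon P m.
Proof.
rewrite /mon /wdeg -prodrXr -big_split; apply: eq_bigr => i _.
by rewrite mxE exprMn exprM.
Qed.

Lemma wpart_wact a K s P : wpart a K (wact s P) = s ^+ K * wpart a K P.
Proof.
by rewrite /wpart mulr_sumr; apply: eq_bigr => m /eqP mK; rewrite mon_wact mK mulrCA.
Qed.

Lemma wactM s t P : wact s (wact t P) = wact (s * t) P.
Proof. by apply/rowP => i; rewrite !mxE exprMn mulrA. Qed.

Lemma wact1 P : wact 1 P = P.
Proof. by apply/rowP => i; rewrite !mxE expr1n mul1r. Qed.

Lemma wdeg_ge m i : (m i <= wdeg m)%N.
Proof.
rewrite /wdeg (bigD1 i) //=; apply: leq_trans (leq_addr _ _).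
by rewrite -{1}(mul1n (m i)) leq_mul2r w0 orbT.
Qed.

Lemma mem_bx_wdeg m N : (wdeg m < N)%N -> m \in bx n N.
Proof.
move=> h; rewrite mem_bx; apply/forallP => i.
exact: leq_ltn_trans (wdeg_ge m i) h.
Qed.

Lemma wpart_bx a K N P : (K < N)%N ->
  \sum_(m <- bx n N | wdeg m == K) a m * mon P m = wpart a K P.
Proof.
move=> KN; rewrite /wpart -!(big_filter (bx _ _)); apply: perm_big.
apply: uniq_perm; rewrite ?filter_uniq ?bx_uniq // => m; rewrite !mem_filter.
by case: eqP => //= mK; rewrite !mem_bx_wdeg ?mK.
Qed.

Lemma in_pd_wact s P (e : R) : nm s <= 1 -> in_pd e P -> in_pd (nm s * e) (wact s P).
Proof.
move=> s1 Pe i; rewrite mxE nmM nmX; apply: ler_pM => //.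
  by rewrite exprn_ge0.
by rewrite -[w i]prednK // exprS ler_piMr // exprn_ile1.
Qed.

(** Along the orbit of [P] the series is a power series in [s] with the weighted parts as
    coefficients; this is its Taylor estimate at the first order that can be nonzero. *)
Lemma wexpansion a r M K P s : 0 <= r -> nle a r M -> in_pd r P -> nm s <= 1 ->
  (forall k, (k < K)%N -> wpart a k P = 0) ->
  nm (ps_eval a (wact s P) - s ^+ K * wpart a K P) <= M * nm s ^+ K.+1.
Proof.
move=> r0 aM Pr s1 low.
have sPr : in_pd r (wact s P).
  move=> i; apply: le_trans (in_pd_wact s1 Pr i) _.
  by apply: ler_piMl.
have cl := climD (ps_eval_clim r0 aM sPr) (clim_const (- (s ^+ K * wpart a K P))).
apply: (clim_nm_le (N := K.+1) cl) => N KN.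
have psE : psum a (wact s P) N = \sum_(m <- bx n N) s ^+ wdeg m * (a m * mon P m).
  by apply: eq_bigr => m _; rewrite mon_wact mulrCA.
have lowE : \sum_(m <- bx n N | (wdeg m <= K)%N) s ^+ wdeg m * (a m * mon P m) =
    s ^+ K * wpart a K P.
  rewrite (partition_big (fun m => inord (wdeg m) : 'I_K.+1) xpredT) //=.
  rewrite (bigD1 ord_max) //= [X in _ + X]big1 ?addr0 => [|k kK].
    rewrite -(wpart_bx a P KN) mulr_sumr; apply: eq_big => [m|m /andP[mK]].
      apply/andP/eqP => [[mK /eqP e]|->]; last first.
        by rewrite leqnn; split=> //; apply/eqP/val_inj; rewrite /= inordK.
      by rewrite -[LHS](@inordK K) // e.
    by move=> /eqP e; rewrite -[wdeg m](@inordK K) // e.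
  rewrite (eq_bigr (fun m => s ^+ k * (a m * mon P m))) => [|m /andP[mK /eqP e]]; last first.
    by rewrite -[wdeg m](@inordK K) // e.
  rewrite -mulr_sumr -[X in _ * X](_ : wpart a k P = _).
    rewrite low ?mulr0 // ltn_neqAle -ltnS ltn_ord andbT.
    by apply: contra kK => /eqP e; apply/eqP/val_inj.
  have kN : (k < N)%N by apply: leq_trans (ltn_ord k) _.
  rewrite -(wpart_bx a P kN); apply: eq_bigl => m.
  apply/eqP/andP => [mk|[mK /eqP e]].
    rewrite mk -ltnS ltn_ord; split=> //; apply/eqP/val_inj.
    by rewrite /= inordK // ltn_ord.
  by rewrite -[LHS](@inordK K) // e.
rewrite psE (bigID (fun m => (wdeg m <= K)%N)) /= lowE addrAC subrr add0r.
apply: le_trans (nm_sum _ _ _) _.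
have : \sum_(m <- bx n N) nm s ^+ K.+1 * (nm (a m) * r ^+ mi_deg m) <= nm s ^+ K.+1 * M.
  by rewrite -mulr_sumr; apply: ler_wpM2l (aM N); rewrite exprn_ge0.
rewrite [M * _]mulrC; apply: le_trans.
rewrite big_mkcond /=; apply: ler_sum => m _; case: ifP => [|_]; last first.
  by rewrite !mulr_ge0 // exprn_ge0.
rewrite -ltnNge => mK; rewrite !nmM nmX; apply: ler_pM => //.
- by rewrite exprn_ge0.
- by rewrite mulr_ge0.
- by apply: ler_wiXn2l => //; rewrite nm_ge0.
- by apply: ler_wpM2l => //; apply: nm_mon.
Qed.

(** If all parts vanish at [P], they vanish at [Q = 2 . P], which still lies in the domain because
    the radius was divided by [2^W]. The Taylor estimate at [P = (1/2) . Q] then holds to every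
    order, so the value is 0. *)
Lemma wpart_neq0 a : convergent a ->
  near0 (fun P => ps_eval a P != 0 -> exists K, wpart a K P != 0).
Proof.
move=> /convergentP[r r0 [M aM]].
pose W := (\max_i w i)%N.
have c0 : 0 < r / 2 ^+ W by rewrite divr_gt0 // exprn_gt0.
exists (r / 2 ^+ W) => // P Pc; apply: contraNP => h.
have z K : wpart a K P = 0.
  by apply/eqP; apply: contrapT => /negP hK; apply: h; exists K.
pose Q := wact 2%:R P.
have two : nm (2%:R : R[i]) = 2.
  by rewrite -[2%:R](rmorph_nat (real_complex R) 2) nmR // ler0n.
have Qr : in_pd r Q.
  move=> i; rewrite mxE nmM nmX two.
  have : 2 ^+ w i * nm (P 0 i : R[i]) <= 2 ^+ W * (r / 2 ^+ W).
    apply: ler_pM => //.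
    by rewrite ler_weXn2l ?ler1n //; apply: (leq_bigmax i).
  by rewrite mulrCA divff ?mulr1 // gt_eqF // exprn_gt0.
have PQ : P = wact 2^-1 Q by rewrite wactM mulVf ?wact1 // pnatr_eq0.
have hs : nm (2^-1 : R[i]) <= 1 by rewrite nmV two; lra.
rewrite -nm_eq0 eq_le nm_ge0 andbT; apply/ler_addgt0Pr => e e0; rewrite add0r.
have M0 := nle_ge0 (ltW r0) aM.
have [N HN] := small_geo M0 e0.
have := @wexpansion a r M N Q 2^-1 (ltW r0) aM Qr hs.
rewrite -PQ wpart_wact z !mulr0 subr0 => /(_ _)/le_trans; apply.
  by move=> k _; rewrite wpart_wact z mulr0.
rewrite nmV two exprVn; exact/ltW/HN/ltnW.
Qed.

Lemma in_pd_small (e : R) P : 0 < e -> exists2 d : R, 0 < d &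
  forall s, nm s <= d -> nm s <= 1 /\ in_pd e (wact s P).
Proof.
move=> e0; pose C := \sum_i nm (P 0 i : R[i]) + 1.
have C0 : 0 < C by rewrite ltr_wpDl // sumr_ge0.
have PC : in_pd C P.
  by move=> i; rewrite /C (bigD1 i) //= -addrA lerDl addr_ge0 // sumr_ge0.
exists (Num.min 1 (e / C)); first by rewrite lt_min ltr01 divr_gt0.
move=> s; rewrite le_min => /andP[s1 se]; split=> // i.
by apply: le_trans (in_pd_wact s1 PC i) _; rewrite -ler_pdivlMr.
Qed.

(** The lowest nonvanishing part dominates for small [s]. As [P] may be far from 0, it is first
    moved into the domain by the scalar [d]. *)
Lemma wpart_neq0_germ a K P : convergent a -> wpart a K P != 0 ->
  exists2 d : R, 0 < d & forall s, s != 0 -> nm s <= d -> ps_eval a (wact s P) != 0.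
Proof.
move=> /convergentP[r r0 [M aM]] aK.
have exK : exists K, wpart a K P != 0 by exists K.
case: (ex_minnP exK) => {aK exK} k ak kmin.
have low j : (j < k)%N -> wpart a j P = 0.
  by move=> jk; apply/eqP; apply: contraLR jk => /kmin; rewrite -leqNgt.
have [d d0 hd] := in_pd_small P r0.
have nd : nm d%:C = d by rewrite nmR // ltW.
have [d1 dr] := hd d%:C (eq_ind_r (fun z => z <= d) (lexx d) nd).
have dc : d%:C != 0 :> R[i] by rewrite -nm_gt0 nd.
pose L := nm (wpart a k P) * d ^+ k.
have L0 : 0 < L by rewrite mulr_gt0 ?nm_gt0 // exprn_gt0.
have M0 : 0 < M + 1 by rewrite ltr_wpDl // (nle_ge0 (ltW r0) aM).
(* With [t = s / d], vanishing would force [L <= M |t|]; below [b] this fails. *)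
pose b := Num.min d (d * L / (M + 1)).
have b0 : 0 < b by rewrite lt_min d0 divr_gt0 // mulr_gt0.
exists (b / 2); first by rewrite divr_gt0.
move=> s s0 sb.
have sbb : nm s < b by apply: le_lt_trans sb _; lra.
have bd : b <= d by rewrite ge_min lexx.
pose t := s / d%:C.
have nt : nm t = nm s / d by rewrite nmM nmV nd.
have t1 : nm t <= 1 by rewrite nt ler_pdivrMr // mul1r ltW // (lt_le_trans sbb).
have t0 : 0 < nm t by rewrite nm_gt0 mulf_neq0 // invr_neq0.
have sE : wact s P = wact t (wact d%:C P) by rewrite wactM divfK.
have lowd j : (j < k)%N -> wpart a j (wact d%:C P) = 0.
  by move=> jk; rewrite wpart_wact low ?mulr0.
have := wexpansion (ltW r0) aM dr t1 lowd.
rewrite -sE wpart_wact => h; apply/negP => /eqP z.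
clearbody t; move: h; rewrite z sub0r nmN !nmM !nmX nd [d ^+ k * _]mulrC -/L exprSr mulrA.
rewrite [M * _]mulrC -mulrA ler_pM2l ?exprn_gt0 // nt mulrA ler_pdivlMr // => h.
have : nm s < d * L / (M + 1) by apply: lt_le_trans sbb _; rewrite ge_min lexx orbT.
rewrite ltr_pdivlMr //; have := nm_ge0 s; lra.
Qed.


End Weights.

(** * Leading terms at a branch point *)

Section BranchPoint.
Variable R : realType.
Local Notation C := R[i].

Lemma anal_horner n (p : {poly C}) (f : Cspace R n -> C) : anal f -> anal (fun x => p.[f x]).
Proof.
move=> fa; apply: (anal_ext (f := fun x => \sum_(i < size p) p`_i * f x ^+ i)).
  by move=> x; rewrite horner_coef.
by apply: anal_sum => i; apply: analM; [exact: anal_cst|exact: analX].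
Qed.

Let iu : 'I_2 := ord0.
Let iy : 'I_2 := ord_max.

(* On the curve [y^b = - D(x)], with [D = (x - xi) E] and [E(xi) != 0], [y] is a
   uniformizer at [(xi, 0)], so the terms of a polynomial of degree less than [b]
   in [y] have distinct orders of vanishing there. *)
Lemma reduced_leading (b : nat) (rho : {poly {poly C}}) (D E : {poly C}) (xi : C) :
  (0 < b)%N -> rho != 0 -> (size rho <= b)%N -> D = E * ('X - xi%:P) -> E.[xi] != 0 ->
  exists theta : Cspace R 2 -> C, [/\ anal theta, theta 0 != 0 &
    forall z : Cspace R 2, (z 0 iy : C) ^+ b = - D.[xi + (z 0 iu : C)] -> (z 0 iy : C) != 0 ->
      theta z != 0 -> rho.[(z 0 iy : C)%:P].[xi + (z 0 iu : C)] != 0].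
Proof.
move=> b0 rho0 sb DE Exi.
have fac (c : {poly C}) : exists vt : nat * {poly C},
    c = vt.2 * ('X - xi%:P) ^+ vt.1 /\ (c != 0 -> vt.2.[xi] != 0).
  have [->|c0] := eqVneq c 0; first by exists (0%N, 0); rewrite mul0r.
  have [v [t ht ->]] := multiplicity_XsubC c xi.
  by exists (v, t); split=> // _; move: ht; rewrite c0.
pose vt (i : nat) := proj1_sig (cid (fac rho`_i)).
pose v i := (vt i).1; pose t i := (vt i).2.
have vtE i : rho`_i = t i * ('X - xi%:P) ^+ v i by rewrite /v /t /vt; case: cid => ? [].
have t0 i : rho`_i != 0 -> (t i).[xi] != 0 by rewrite /t /vt; case: cid => ? [].
(* A common bound for the [v i]: multiplication by [E^V] lets every [(x - xi)^(v i)] be rewritten as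
   a power of [- y^b]. *)
pose V := (\sum_(i < size rho) v i)%N.
have vV (i : 'I_(size rho)) : (v i <= V)%N by rewrite /V (bigD1 i) //= leq_addr.
(* The order in [y] of the [i]-th term; these orders differ modulo [b], since [i < b]. *)
pose N (i : nat) := (b * v i + i)%N.
have srho : (0 < size rho)%N by rewrite size_poly_gt0.
have lts : ((size rho).-1 < size rho)%N by rewrite prednK.
have last : rho`_(Ordinal lts) != 0 by rewrite /= -/(lead_coef rho) lead_coef_eq0.
have [i0 i0n i0min] : exists2 i0 : 'I_(size rho), rho`_i0 != 0 &
    forall i : 'I_(size rho), rho`_i != 0 -> (N i0 <= N i)%N.
  have := @arg_minnP _ (Ordinal lts) (fun i : 'I_(size rho) => rho`_i != 0)
    (fun i : 'I_(size rho) => N i) last.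
  by case=> i h1 h2; exists i.
have Ndist (i : 'I_(size rho)) : i != i0 -> rho`_i != 0 -> (0 < N i - N i0)%N.
  move=> ii0 ri; rewrite subn_gt0 ltn_neqAle i0min // andbT; apply: contra ii0 => /eqP e.
  apply/eqP/val_inj => /=; have hi : (i < b)%N by apply: leq_trans (ltn_ord i) sb.
  have hi0 : (i0 < b)%N by apply: leq_trans (ltn_ord i0) sb.
  have := congr1 (fun m => m %% b)%N e.
  by rewrite /N ![(b * _)%N]mulnC !modnMDl !modn_small // => ->.
pose x (z : Cspace R 2) : C := xi + (z 0 iu : C).
(* Zero coefficients are set apart because [i0] is minimal only among the others; for those the
   subtraction [N i - N i0] is exact. *)
pose F (i : 'I_(size rho)) : Cspace R 2 -> C := if rho`_i == 0 then fun=> 0 else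
  fun z => (t i).[x z] * E.[x z] ^+ (V - v i) * (-1) ^+ v i * (z 0 iy : C) ^+ (N i - N i0).
have xa : anal x by apply: analD; [exact: anal_cst|exact: anal_coord].
exists (fun z => \sum_i F i z); split.
- apply: anal_sum => i; rewrite /F; case: ifP => _; first exact: anal_cst.
  apply: analM; last by apply: analX; exact: anal_coord.
  apply: analM; last exact: anal_cst.
  by apply: analM; [|apply: analX]; exact: anal_horner.
- have x0 : x 0 = xi by rewrite /x mxE addr0.
  rewrite (bigD1 i0) //= big1 ?addr0 => [|i ii0].
    rewrite /F (negPf i0n) x0 subnn expr0 mulr1 !mulf_neq0 ?expf_neq0 ?oppr_eq0 ?oner_eq0 //.
    exact: t0.
  rewrite /F; case: eqP => // /eqP ri.
  by rewrite mxE expr0n gtn_eqF ?mulr0 // Ndist.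
- move=> z yb y0; set y : C := z 0 iy in yb y0 *; rewrite -/(x z) in yb *.
  apply: contra => /eqP rz.
  have uE : (z 0 iu : C) * E.[x z] = - y ^+ b.
    by rewrite yb opprK DE !hornerE mulrC; congr (_ * _); rewrite /x addrAC subrr add0r.
  (* On the curve, [rho] is up to the factor [E^V] the lowest power of [y] times [theta]. *)
  have : y ^+ N i0 * \sum_i F i z = E.[x z] ^+ V * rho.[y%:P].[x z].
    rewrite (horner_coef rho) horner_sum !mulr_sumr; apply: eq_bigr => i _.
    rewrite hornerM horner_exp hornerC vtE /F.
    case: eqP => [ri|/eqP ri].
      by rewrite -vtE ri horner0 mul0r !mulr0.
    rewrite hornerM horner_exp hornerXsubC [x z - xi](_ : _ = (z 0 iu : C)); last first.
      by rewrite /x addrAC subrr add0r.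
    have -> : y ^+ N i0 * ((t i).[x z] * E.[x z] ^+ (V - v i) * (-1) ^+ v i *
        y ^+ (N i - N i0)) = (t i).[x z] * E.[x z] ^+ (V - v i) * (-1) ^+ v i *
        y ^+ N i.
      by rewrite mulrCA -exprD subnKC // i0min.
    rewrite /N exprD [y ^+ (b * v i)]exprM mulrA -[_ * (-1) ^+ v i * _]mulrA.
    rewrite -exprMn mulN1r -uE exprMn -{2}(subnK (vV i)) exprD.
    move: (E.[x z] ^+ (V - v i)) (E.[x z] ^+ v i) (_ ^+ v i) (y ^+ i) => q1 q2 q3 q4.
    ring.
  rewrite rz mulr0 => /eqP; rewrite mulf_eq0 expf_eq0 (negPf y0) andbF /=.
  by [].
Qed.

End BranchPoint.

(** * The coordinate ring of the surface is a domain *)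

Section Irreducible.
Variable R : realType.
Local Notation C := R[i].
Local Notation T := {poly {poly {poly C}}}.
Import Pdiv.Ring Pdiv.RingMonic.

(* The outermost variable is [y], then [x], then [z]. *)
Definition ev (p : T) (x y z : C) : C := p.[y%:P%:P].[x%:P].[z].

Lemma exists_nonroot (p : {poly C}) : p != 0 -> exists z, p.[z] != 0.
Proof.
move=> p0; apply: contrapT => h.
have : all (root p) [seq (k%:R : C) | k <- iota 0 (size p)].
  apply/allP => z _; apply/eqP; apply: contrapT => /eqP pz.
  by apply: h; exists z.
move=> /(max_poly_roots p0); rewrite map_inj_uniq ?iota_uniq => [/(_ isT)|].
  by rewrite size_map size_iota ltnn.
by move=> i j /eqP; rewrite eqr_nat => /eqP.
Qed.

Definition slice (z0 : C) (p : T) : {poly {poly C}} := map_poly (map_poly (horner_eval z0)) p.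

Lemma ev_slice (z0 : C) p x y : ev p x y z0 = (slice z0 p).[y%:P].[x].
Proof.
pose f := map_poly (horner_eval z0) : {poly {poly C}} -> {poly C}.
have fy : f (y%:P%:P) = y%:P by rewrite /f map_polyC /= horner_evalE hornerC.
rewrite /slice -[y%:P in RHS]fy horner_map /= /ev.
have -> : x = horner_eval z0 x%:P by rewrite horner_evalE hornerC.
by rewrite horner_map /= !horner_evalE hornerC.
Qed.

Lemma slice_neq0 (z0 : C) p : (lead_coef (lead_coef p)).[z0] != 0 -> slice z0 p != 0.
Proof.
apply: contraNneq => h.
have := congr1 (fun q : {poly {poly C}} => q`_(size p).-1`_(size (lead_coef p)).-1) h.
by rewrite /slice !coef_map /= horner_evalE !coef0 => ->.
Qed.

(** Both polynomials are reduced modulo the equation, monic of degree 30 in [y]. If both remainders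
    are nonzero, a slice is chosen on which they stay nonzero, and on it a curve point near
    [(xi, 0)] at which neither vanishes. *)
Lemma ev_irreducible (p q : T) :
  (forall x y z, x ^+ 40 + y ^+ 30 + z ^+ 24 = 0 -> ev p x y z * ev q x y z = 0) ->
  (forall x y z, x ^+ 40 + y ^+ 30 + z ^+ 24 = 0 -> ev p x y z = 0) \/
  (forall x y z, x ^+ 40 + y ^+ 30 + z ^+ 24 = 0 -> ev q x y z = 0).
Proof.
move=> pq; pose D : {poly {poly C}} := 'X^40 + ('X^24)%:P.
pose B : T := 'X^30 + D%:P.
have sB : size B = 31%N.
  by rewrite /B size_polyDl size_polyXn // (leq_ltn_trans (size_polyC_leq1 _)).
have mB : B \is monic.
  rewrite monicE /lead_coef sB coefD coefXn eqxx coefC /= addr0 //.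
have red (f : T) x y z : x ^+ 40 + y ^+ 30 + z ^+ 24 = 0 -> ev f x y z = ev (rmodp f B) x y z.
  move=> h; rewrite {1}(rdivp_eq mB f) /ev !hornerD !hornerM -/(ev B x y z).
  have -> : ev B x y z = 0; last by rewrite mulr0 add0r.
  rewrite -h /ev /B /D !(hornerD, hornerXn, hornerC, horner_exp).
  by rewrite addrA [_ + x ^+ _]addrC.
have sr (f : T) : (size (rmodp f B) <= 30)%N.
  by have := ltn_rmodp f B; rewrite sB monic_neq0.
have [p0|p0] := eqVneq (rmodp p B) 0.
  by left=> x y z h; rewrite red // p0 /ev !horner0.
have [q0|q0] := eqVneq (rmodp q B) 0.
  by right=> x y z h; rewrite red // q0 /ev !horner0.
exfalso.
(* The factor ['X] forces [z0 != 0], which makes the roots of [x^40 + z0^24] simple. *)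
have [z0] : exists z0, (lead_coef (lead_coef (rmodp p B)) *
    lead_coef (lead_coef (rmodp q B)) * 'X).[z0] != 0.
  by apply: exists_nonroot; rewrite !mulf_neq0 ?lead_coef_eq0 ?polyX_eq0.
rewrite !hornerM hornerX !mulf_eq0 !negb_or => /andP[/andP[lp lq] z00].
have [rp0 rq0] := (slice_neq0 lp, slice_neq0 lq).
have ssl f : (size (slice z0 (rmodp f B)) <= 30)%N.
  by apply: leq_trans (size_poly _ _) (sr f).
pose D0 : {poly C} := 'X^40 + (z0 ^+ 24)%:P.
pose xi : C := 40.-root (- z0 ^+ 24).
have xiE : xi ^+ 40 = - z0 ^+ 24 by rewrite rootCK.
have xi0 : xi != 0.
  apply: contraNneq z00 => h; move: xiE; rewrite h expr0n => /eqP.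
  by rewrite eq_sym oppr_eq0 expf_eq0.
have rD : root D0 xi by rewrite /root hornerD hornerXn hornerC xiE addNr.
have [E DE] := factor_theorem D0 xi rD.
have Exi : E.[xi] != 0.
  have := congr1 (fun f => f^`().[xi]) DE; rewrite derivM derivXsubC hornerD hornerM mulr1.
  rewrite hornerXsubC subrr mulr0 add0r /D0 derivD derivXn derivC addr0 => <-.
  by rewrite hornerMn hornerXn mulrn_eq0 negb_or expf_neq0.
have [th [tha th0 thP]] := reduced_leading (isT : (0 < 30)%N) rp0 (ssl p) DE Exi.
have [ta [taa ta0 taP]] := reduced_leading (isT : (0 < 30)%N) rq0 (ssl q) DE Exi.
have [e e0 he] := near0_and (anal_neq0 tha th0) (anal_neq0 taa ta0).
have xa : anal (fun z : Cspace R 2 => xi + (z 0 ord0 : C)).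
  by apply: analD; [exact: anal_cst|exact: anal_coord].
have Ea := anal_horner E xa; have Da := anal_horner D0 xa.
have E0 : E.[xi + (0 : Cspace R 2) 0 ord0] != 0 by rewrite mxE addr0.
have e30 : 0 < e ^+ 30 by rewrite exprn_gt0.
(* Keeping [|D0|] below [e^30] makes its 30th root [y] smaller than [e]. *)
have [d /andP[d0 de] hd] := near0_ball e0 (near0_and (anal_neq0 Ea E0) (anal_cont Da e30)).
pose u : C := d%:C; have nu : nm u = d by rewrite nmR // ltW.
pose y : C := 30.-root (- D0.[xi + u]).
have yE : y ^+ 30 = - D0.[xi + u] by rewrite rootCK.
pose z : Cspace R 2 := \row_i (if i == ord0 then u else y : R[i]^o).
have zu : (z 0 ord0 : C) = u by rewrite mxE.
have zy : (z 0 ord_max : C) = y by rewrite mxE.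
(* [E] and [D0] depend on the first coordinate only, so [hd] can be used at [(u, 0)] before [y] is
   known to be small. *)
pose z' : Cspace R 2 := \row_i (if i == ord0 then u else 0 : R[i]^o).
have zu' : (z' 0 ord0 : C) = u by rewrite mxE.
have [] := hd z'; first by move=> i; rewrite mxE; case: ifP; rewrite ?nu ?nm0 // ltW.
rewrite zu' mxE addr0 => Eu; have -> : D0.[xi] = 0 by exact/eqP.
rewrite subr0 => Du.
have y0 : y != 0.
  have : y ^+ 30 != 0.
    by rewrite yE oppr_eq0 DE hornerM mulf_neq0 // hornerXsubC addrAC subrr add0r -nm_gt0 nu.
  by rewrite expf_eq0.
have ye : nm y <= e.
  have : nm y ^+ 30 < e ^+ 30 by rewrite -nmX yE nmN.
  rewrite ltr_pXn2r // ?nnegrE ?(ltW e0) //; exact: ltW.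
have [thz taz] : th z != 0 /\ ta z != 0.
  by apply: he => i; rewrite mxE; case: ifP; rewrite ?nu.
have := thP z; rewrite zu zy => /(_ yE y0 thz) hp.
have := taP z; rewrite zu zy => /(_ yE y0 taz) hq.
have X : (xi + u) ^+ 40 + y ^+ 30 + z0 ^+ 24 = 0.
  by rewrite yE /D0 hornerD hornerXn hornerC opprD addrA subrr sub0r addNr.
have := pq _ _ _ X; rewrite (red p _ _ _ X) (red q _ _ _ X) !ev_slice => /eqP.
by rewrite mulf_eq0 (negPf hp) (negPf hq).
Qed.

End Irreducible.

(** * The germ of the Brieskorn surface *)

Section Germ.
Variable R : realType.
Local Notation C := R[i].
Local Notation T := {poly {poly {poly C}}}.

Definition brieskorn_germ : set (Cspace R 3) := [set x | brieskorn x = 0].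

Definition w345 (i : 'I_3) : nat := (3 + i)%N.

Let w0 i : (0 < w345 i)%N. Proof. by []. Qed.

Lemma brieskorn_wact s (P : Cspace R 3) : brieskorn (wact w345 s P) = s ^+ 120 * brieskorn P.
Proof.
have h (x : C) k m : (k * m = 120)%N -> (s ^+ k * x) ^+ m = s ^+ 120 * x ^+ m.
  by move=> km; rewrite exprMn -exprM km.
by rewrite /brieskorn !mxE !h ?mulrDr // /w345 inordK.
Qed.

Lemma anal_brieskorn : anal (@brieskorn R).
Proof. by apply: analD; [apply: analD|]; apply: analX; exact: anal_coord. Qed.

Definition wpoly (a : multi_index 3 -> C) K : T :=
  \sum_(m <- bx 3 K.+1 | wdeg w345 m == K)
    'X^(m (inord 1)) * ((a m)%:P%:P * 'X^(m (inord 0)) * ('X^(m (inord 2)))%:P)%:P.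

Lemma ev_wpoly a K (P : Cspace R 3) :
  ev (wpoly a K) (P 0 (inord 0)) (P 0 (inord 1)) (P 0 (inord 2)) = wpart w345 a K P.
Proof.
rewrite /ev /wpoly !horner_sum; apply: eq_bigr => m _.
rewrite !(hornerM, hornerXn, hornerC, horner_exp).
have -> : mon P m = (P 0 (inord 0) : C) ^+ m (inord 0) * (P 0 (inord 1) : C) ^+ m (inord 1) *
    (P 0 (inord 2) : C) ^+ m (inord 2).
  rewrite /mon !big_ord_recl big_ord0 mulr1 mulrA.
  have e0 : inord 0 = ord0 :> 'I_3 by apply: val_inj; rewrite /= inordK.
  have e1 : inord 1 = lift ord0 ord0 :> 'I_3 by apply: val_inj; rewrite /= inordK.
  have e2 : inord 2 = lift ord0 (lift ord0 ord0) :> 'I_3 by apply: val_inj; rewrite /= inordK.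
  by rewrite e0 e1 e2.
move: (_ ^+ m (inord 0)) (_ ^+ m (inord 1)) (_ ^+ m (inord 2)) => q0 q1 q2; ring.
Qed.

Lemma wpart_irreducible (a b : multi_index 3 -> C) K L :
  (forall P, brieskorn P = 0 -> wpart w345 a K P * wpart w345 b L P = 0) ->
  (forall P, brieskorn P = 0 -> wpart w345 a K P = 0) \/
  (forall P, brieskorn P = 0 -> wpart w345 b L P = 0).
Proof.
move=> ab.
pose pt (x y z : C) : Cspace R 3 :=
  \row_i (if i == inord 0 then x else if i == inord 1 then y else z : R[i]^o).
have i10 : (inord 1 == inord 0 :> 'I_3) = false by rewrite -val_eqE /= !inordK.
have i20 : (inord 2 == inord 0 :> 'I_3) = false by rewrite -val_eqE /= !inordK.
have i21 : (inord 2 == inord 1 :> 'I_3) = false by rewrite -val_eqE /= !inordK.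
have px x y z : pt x y z 0 (inord 0) = x by rewrite mxE eqxx.
have py x y z : pt x y z 0 (inord 1) = y by rewrite mxE i10 eqxx.
have pz x y z : pt x y z 0 (inord 2) = z by rewrite mxE i20 i21.
case: (@ev_irreducible R (wpoly a K) (wpoly b L)) => [x y z h|h|h].
- have := ab (pt x y z); rewrite -!ev_wpoly /brieskorn px py pz; exact.
- by left=> P PX; rewrite -ev_wpoly; apply: h.
- by right=> P PX; rewrite -ev_wpoly; apply: h.
Qed.

Lemma analytic_germ_brieskorn : analytic_germ brieskorn_germ.
Proof.
have := @analytic_germ_anal R 3 1 (fun=> @brieskorn R) (fun=> anal_brieskorn).
have -> // : [set x | forall j : 'I_1, brieskorn x = 0] = brieskorn_germ.
by apply/seteqP; split=> x //= h; exact: (h ord0).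
Qed.

Lemma brieskorn0 : brieskorn (0 : Cspace R 3) = 0.
Proof. by rewrite /brieskorn !mxE !expr0n !addr0. Qed.

(** The series [F] comes from [anal_brieskorn] and is known only through its values: it is nonzero
    by evaluation on the [x]-axis, and not a unit because its constant coefficient is its value at
    0. *)
Lemma hypersurface_brieskorn : hypersurface_germ brieskorn_germ.
Proof.
have [F cF FE] := anal_brieskorn.
have [r r0 [M FM]] := (convergentP F).1 cF.
have F0 : F (mi0 3) = 0.
  rewrite -(ps_eval0 (ltW r0) FM) -brieskorn0.
  by have [e e0 ->] := FE => // i; rewrite mxE nm0 ltW.
exists F; split=> //.
- apply: contrapT => h.
  have Fz : F = @szero R 3.
    apply/funext => m; apply/eqP; apply: contrapT => /negP Fm; apply: h.
    by exists m.
  have [e e0 he] := FE.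
  pose t : R := Num.min e 1; have t0 : 0 < t by rewrite lt_min e0 ltr01.
  pose x : Cspace R 3 := \row_i (if i == inord 0 then t%:C else 0 : R[i]^o).
  have xe : in_pd e x.
    move=> i; rewrite mxE; case: ifP => _; last by rewrite nm0 ltW.
    by rewrite nmR ?(ltW t0) // ge_min lexx.
  have := he x xe; rewrite Fz ps_eval_zero /brieskorn !mxE eqxx.
  have -> : (inord 1 == inord 0 :> 'I_3) = false by rewrite -val_eqE /= !inordK.
  have -> : (inord 2 == inord 0 :> 'I_3) = false by rewrite -val_eqE /= !inordK.
  rewrite !expr0n !addr0 => /eqP; rewrite expf_eq0 /= -nm_eq0 nmR ?(ltW t0) //.
  by rewrite gt_eqF.
- move=> [b _ Fb]; have := congr1 (fun f => f (mi0 3)) Fb.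
  rewrite /ps_mul /ps_one mi_deg0 eqxx big1 => [|k _].
    by move/eqP; rewrite eq_sym oner_eq0.
  have -> : [ffun i => nat_of_ord (k i)] = mi0 3.
    apply/ffunP => i; have m0 : mi0 3 i = 0%N by rewrite ffunE.
    have : (k i <= 0)%N by rewrite -[X in (_ <= X)%N]m0 -ltnS ltn_ord.
    by rewrite leqn0 => /eqP ki; rewrite [RHS]m0 ffunE.
  by rewrite F0 mul0r.
- by apply/germ_eqP; apply: near0_imp FE => x Fx; rewrite /brieskorn_germ /zero_set /= Fx.
Qed.

(** [G] collects conditions valid near 0 that the separating point has to satisfy as well. *)
Lemma not_germ_eq (A X : set (Cspace R 3)) (G : Cspace R 3 -> Prop) :
  near0 G -> near0 (fun x => A x -> X x) -> ~ germ_eq A X -> exists x, [/\ G x, X x & ~ A x].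
Proof.
move=> hG AX nAX; apply: contrapT => h; apply: nAX; apply/germ_eqP.
apply: near0_imp (near0_and hG AX) => x [Gx AXx]; split=> // Xx.
by apply: contrapT => Ax; apply: h; exists x.
Qed.

Lemma irreducible_brieskorn : irreducible_germ brieskorn_germ.
Proof.
split; first exact: analytic_germ_brieskorn.
  move/germ_eqP => [e e0 he].
  have [|h _] := he 0; first by move=> i; rewrite mxE nm0 ltW.
  by apply: h; exact: brieskorn0.
move=> [A1 [A2 [[k1 [F1 [cF1 /germ_eqP A1E]]] [k2 [F2 [cF2 /germ_eqP A2E]]] /germ_eqP XE n1 n2]]].
(* A proper component has an equation with a weighted part that is nonzero somewhere on [X]. *)
have good k (F : 'I_k -> Defs.pseries R 3) A : (forall j, convergent (F j)) ->
    near0 (fun x => A x <-> (\bigcap_(j : 'I_k) zero_set (F j)) x) ->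
    near0 (fun x => A x -> brieskorn_germ x) -> ~ germ_eq A brieskorn_germ ->
    exists (j : 'I_k) K P, brieskorn P = 0 /\ wpart w345 (F j) K P != 0.
  move=> cF AE AX nA.
  have hw := near0_forall (fun j => wpart_neq0 w0 (cF j)).
  have [P [[hP AP] PX nAP]] := not_germ_eq (near0_and hw AE) AX nA.
  have [j Fj] : exists j, ps_eval (F j) P != 0.
    apply: contrapT => h; apply: nAP; apply/AP => j _.
    by apply/eqP; apply: contrapT => /negP Fj; apply: h; exists j.
  by have [K hK] := hP j Fj; exists j, K, P.
have AX1 : near0 (fun x => A1 x -> brieskorn_germ x).
  by apply: near0_imp XE => x Xx A1x; apply/Xx; left.
have AX2 : near0 (fun x => A2 x -> brieskorn_germ x).
  by apply: near0_imp XE => x Xx A2x; apply/Xx; right.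
have [j1 [K1 [P1 [P1X P1n]]]] := good _ _ _ cF1 A1E AX1 n1.
have [j2 [K2 [P2 [P2X P2n]]]] := good _ _ _ cF2 A2E AX2 n2.
case: (@wpart_irreducible (F1 j1) (F2 j2) K1 K2) => [P PX|h|h]; last 2 first.
- by rewrite h ?eqxx in P1n.
- by rewrite h ?eqxx in P2n.
(* If both parts were nonzero at [P], the point [s . P] with small [s] would lie on [X] but in
   neither component. *)
apply/eqP; rewrite mulf_eq0; apply: contrapT => /negP; rewrite negb_or => /andP[w1 w2].
have [d1 d10 h1] := wpart_neq0_germ w0 (cF1 j1) w1.
have [d2 d20 h2] := wpart_neq0_germ w0 (cF2 j2) w2.
have [e e0 he] := near0_and XE (near0_and A1E A2E).
have [d d0 hd] := in_pd_small w0 P e0.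
pose s : R := Num.min d (Num.min d1 d2).
have s0 : 0 < s by rewrite !lt_min d0 d10.
have ns : nm s%:C = s by rewrite nmR // ltW.
have sc : s%:C != 0 :> C by rewrite -nm_gt0 ns.
have sd : nm s%:C <= d by rewrite ns ge_min lexx.
have sd1 : nm s%:C <= d1 by rewrite ns !ge_min lexx orbT.
have sd2 : nm s%:C <= d2 by rewrite ns !ge_min lexx !orbT.
have [_ sP] := hd _ sd; have [Xs [A1s A2s]] := he _ sP.
have sX : brieskorn_germ (wact w345 s%:C P).
  by rewrite /brieskorn_germ /= brieskorn_wact PX mulr0.
case/Xs: sX => [/A1s/(_ j1 I)|/A2s/(_ j2 I)]; rewrite /zero_set /= => /eqP.
  by rewrite (negPf (h1 _ sc sd1)).
by rewrite (negPf (h2 _ sc sd2)).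
Qed.

End Germ.

Theorem corollary4p3 (R : realType) :
  exists n : nat, (1 <= n)%N /\
    exists X : set (Cspace R n.+1),
      [/\ hypersurface_germ X,
          irreducible_germ X &
          forall Y : set (Cspace R n.+1),
            smooth_surface_germ Y -> reducible_germ (X `&` Y)].
Proof.
exists 2%N; split=> //; exists (@brieskorn_germ R); split.
- exact: hypersurface_brieskorn.
- exact: irreducible_brieskorn.
move=> Y [_ [Phi [Psi [bih /germ_eqP YE]]]].
(* In dimension 3 a smooth surface is cut out by the last chart coordinate alone. *)
have [g [ga g0 gE]] := chart_coordinate ord_max bih.
have cPhi : convergent (Phi ord_max) by case: bih.
apply: (reducible_smooth (anal_ps cPhi) ga g0 gE).
apply: near0_imp YE => x Yx; rewrite /setI /=; split=> -[Xx].
  by move=> /Yx/(_ ord_max (leqnn _)); rewrite mxE; split.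
move=> hx; split=> //; apply/Yx => j j2.
have -> : j = ord_max by apply: val_inj; have := ltn_ord j; rewrite /=; move: j2; lia.
by rewrite mxE.
Qed.
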